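(* Let $0<|q|<1$, $n>s\ge1$ with $n\ge2$, $\underline{a}=(a_1,\dots,a_n)\in(q^{\mathbb{R}})^n$, $\underline{b}=(b_1,\dots,b_s)\in(q^{\mathbb{R}}\setminus q^{-\mathbb{N}})^s$ with $b_1=q$, and $\lambda\in\mathbb{C}^\times$. For $(i,j)\in\{1,\dots,n\}\times\{1,\dots,s\}$ let $\alpha_i,\beta_j\in\mathbb{R}$ be such that $a_i=q^{\alpha_i}$ and $b_j=q^{\beta_j}$. Assume that $\alpha_i-\beta_j\notin\mathbb{Z}$ for all such $(i,j)$, and that the algebraic group generated by $\mathrm{Diag}(e^{2i\pi\alpha_1},\dots,e^{2i\pi\alpha_n})$ is connected. Then ${}_n\Phi_s(\underline{a},\underline{b},\lambda,q;z)$ is $\sigma_{\mathbf{q}}$-transcendental over $\mathbb{C}(z^* )$.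
   Context: $\mathbf{q}\in\mathbb{C}^\times$ is a complex number with $|\mathbf{q}|\neq1$ such that $q$ and $\mathbf{q}$ are multiplicatively independent: for $\ell,m\in\mathbb{Z}$, $q^\ell\mathbf{q}^m=1$ implies $\ell=m=0$. Fix a determination $\log q$; for $\alpha\in\mathbb{C}$ put $q^\alpha=e^{\alpha\log q}$, $q^{\mathbb{R}}=\{q^\alpha:\alpha\in\mathbb{R}\}$, $q^{-\mathbb{N}}=\{q^{-m}:m\in\mathbb{N}\}$ with $0\in\mathbb{N}$. The basic hypergeometric series is the formal power series $${}_n\Phi_s(\underline{a},\underline{b},\lambda,q;z)=\sum_{m\ge0}\frac{\prod_{i=1}^n(1-a_i)(1-a_iq)\cdots(1-a_iq^{m-1})}{\prod_{j=1}^s(1-b_j)(1-b_jq)\cdots(1-b_jq^{m-1})}\lambda^mz^m .$$ The algebraic group generated by a matrix is the Zariski closure in $\mathrm{GL}_n(\mathbb{C})$ of the group it generates. $\mathbb{C}(z^* )=\bigcup_{j\ge1}\mathbb{C}(z^{1/j})\subset\mathbb{C}((z^* ))=\bigcup_{j\ge1}\mathbb{C}((z^{1/j}))$. The automorphism $\sigma_{\mathbf{q}}$ of $\mathbb{C}((z^* ))$ is given by $z^{1/j}\mapsto\mathbf{q}_jz^{1/j}$ for a fixed sequence with $\mathbf{q}_j^j=\mathbf{q}$ and $\mathbf{q}_j^l=\mathbf{q}_k$ if $j=lk$; on power series in $z$ it is $f(z)\mapsto f(\mathbf{q}z)$. An element $f$ is $\sigma_{\mathbf{q}}$-transcendental over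 $\mathbb{C}(z^* )$ if $f,\sigma_{\mathbf{q}}(f),\sigma_{\mathbf{q}}^2(f),\dots$ are algebraically independent over $\mathbb{C}(z^* )$. *)

(* Defs.v *)
From HB Require Import structures.
From mathcomp Require Import all_boot all_order all_algebra.
From mathcomp Require Import all_classical all_reals all_analysis.
From mathcomp Require Import complex ring lra zify.
(* The notations of mpoly clash with those of MathComp-Analysis. *)
From mathcomp.multinomials Require Import -(notations) mpoly.

Set Implicit Arguments.
Unset Strict Implicit.
Unset Printing Implicit Defensive.

Import Order.TTheory GRing.Theory Num.Theory.
Local Open Scope classical_set_scope.
Local Open Scope ring_scope.

Section PuiseuxFun.
Variable K : fieldType.
Implicit Types (f g h : rat -> K) (F G H : nat -> K) (j k l : nat) (m : int).

Definition puiseux_supp (j : nat) (m : int) f :=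
  forall r, f r != 0 -> exists k : nat, r = (m%:~R + k%:R) / j%:R.

Definition is_puiseux f :=
  exists j m, (0 < j)%N /\ puiseux_supp j m f.

(* The sum has finitely many nonzero terms when f and g satisfy is_puiseux. *)
Definition puiseux_mul_fun f g : rat -> K :=
  fun r => \sum_(s \in [set: rat]) f s * g (r - s).

(* The function attached to sum_k F(k) z^((m + k) / j). *)
Definition laurent_fun (j : nat) (m : int) F : rat -> K := fun r =>
  let x := r * j%:R - m%:~R in
  if x \is a Num.nat then F (Num.truncn x) else 0.

Definition conv F G : nat -> K := fun k => \sum_(i < k.+1) F i * G (k - i)%N.

Lemma natrat_neq0 j : (0 < j)%N -> (j%:R : rat) != 0.
Proof. by rewrite pnatr_eq0 -lt0n. Qed.

Lemma laurent_funE j m F k : (0 < j)%N ->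
  laurent_fun j m F ((m%:~R + k%:R) / j%:R) = F k.
Proof.
move=> j0; have jn := natrat_neq0 j0.
by rewrite /laurent_fun divfK// addrAC subrr add0r natr_nat natrK.
Qed.

Lemma laurent_fun_supp j m F : (0 < j)%N ->
  puiseux_supp j m (laurent_fun j m F).
Proof.
move=> j0 r; have jn := natrat_neq0 j0.
rewrite /laurent_fun; case: ifPn => [xN _|]; last by rewrite eqxx.
by exists (Num.truncn (r * j%:R - m%:~R)); rewrite truncnK// addrC subrK mulfK.
Qed.

Lemma laurent_fun_puiseux j m F : (0 < j)%N -> is_puiseux (laurent_fun j m F).
Proof. by move=> j0; exists j, m; split=> //; apply: laurent_fun_supp. Qed.

Lemma puiseux_supp_ext j m f g : puiseux_supp j m f -> puiseux_supp j m g ->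
  (forall k, f ((m%:~R + k%:R) / j%:R) = g ((m%:~R + k%:R) / j%:R)) -> f = g.
Proof.
move=> sf sg fg; apply/funext => r.
have [f0|/sf[k ->]//] := eqVneq (f r) 0.
by have [g0|/sg[k ->]//] := eqVneq (g r) 0; rewrite f0 g0.
Qed.

Lemma puiseux_suppE j m f : (0 < j)%N -> puiseux_supp j m f ->
  f = laurent_fun j m (fun k => f ((m%:~R + k%:R) / j%:R)).
Proof.
move=> j0 sf; apply: (puiseux_supp_ext sf (@laurent_fun_supp j m _ j0)) => k.
by rewrite laurent_funE.
Qed.

Lemma puiseux_supp_widen j m l m' f : (0 < j)%N -> (0 < l)%N ->
  m' <= m * l%:Z -> puiseux_supp j m f -> puiseux_supp (j * l) m' f.
Proof.
move=> j0 l0 lem sf r /sf[k ->].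
have jn := natrat_neq0 j0; have ln := natrat_neq0 l0.
exists (k * l + `|(m * l%:Z - m')%R|)%N.
have -> : ((k * l + `|(m * l%:Z - m')%R|)%N%:R : rat)
    = k%:R * l%:R + m%:~R * l%:R - m'%:~R.
  rewrite natrD natrM natr_absz.
  rewrite ger0_norm ?subr_ge0// rmorphB rmorphM /=.
  by rewrite addrA.
by rewrite natrM; field; rewrite jn ln.
Qed.

Lemma is_puiseux_laurent f : is_puiseux f -> exists j, (0 < j)%N /\
  forall l, (0 < l)%N -> exists m0, forall m, m <= m0 ->
    exists F, f = laurent_fun (j * l) m F.
Proof.
move=> [j [m [j0 sf]]]; exists j; split=> // l l0.
exists (m * l%:Z) => m' le'; eexists; apply: puiseux_suppE.
  by rewrite muln_gt0 j0.
exact: puiseux_supp_widen sf.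
Qed.

Lemma is_puiseux_common3 f g h : is_puiseux f -> is_puiseux g -> is_puiseux h ->
  exists j m F G H, [/\ (0 < j)%N, f = laurent_fun j m F,
    g = laurent_fun j m G & h = laurent_fun j m H].
Proof.
move=> /is_puiseux_laurent[j1 [j10 P1]] /is_puiseux_laurent[j2 [j20 P2]].
move=> /is_puiseux_laurent[j3 [j30 P3]].
have [|m1 Q1] := P1 (j2 * j3)%N; first by rewrite muln_gt0 j20.
have [|m2 Q2] := P2 (j1 * j3)%N; first by rewrite muln_gt0 j10.
have [|m3 Q3] := P3 (j1 * j2)%N; first by rewrite muln_gt0 j10.
pose m := Order.min m1 (Order.min m2 m3).
have [|F ->] := Q1 m; first by rewrite /m !ge_min lexx ?orbT.
have [|G ->] := Q2 m; first by rewrite /m !ge_min lexx ?orbT.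
have [|H ->] := Q3 m; first by rewrite /m !ge_min lexx ?orbT.
exists (j1 * j2 * j3)%N, m, F, G, H; split.
- by rewrite !muln_gt0 j10 j20.
- by rewrite mulnA.
- by congr laurent_fun; rewrite mulnCA mulnA.
- by congr laurent_fun; rewrite mulnC.
Qed.

Lemma puiseux_mul_laurent j m m' F G : (0 < j)%N ->
  puiseux_mul_fun (laurent_fun j m F) (laurent_fun j m' G) =
  laurent_fun j (m + m') (conv F G).
Proof.
move=> j0; have jn := natrat_neq0 j0.
apply/funext => r; rewrite /puiseux_mul_fun.
set fF := laurent_fun j m F; set fG := laurent_fun j m' G.
have [rE|rn] := pselect (exists k : nat, r = ((m + m')%:~R + k%:R) / j%:R).
  case: rE => k ->; rewrite laurent_funE//.
  pose e (i : nat) : rat := (m%:~R + i%:R) / j%:R.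
  have e_inj : injective e.
    move=> a b /(congr1 (fun x => x * j%:R)); rewrite /e !divfK//.
    by move/addrI/eqP; rewrite eqr_nat => /eqP.
  rewrite (@fsbigE _ _ _ _ _ (map e (iota 0 k.+1))).
  - rewrite big_map; under eq_bigl do rewrite in_setT.
    rewrite /conv -(big_mkord xpredT (fun i => F i * G (k - i)%N)) /index_iota.
    rewrite subn0 big_seq [RHS]big_seq; apply: eq_bigr => i.
    rewrite mem_iota add0n /= ltnS => lik; rewrite /fF laurent_funE//.
    congr (_ * _).
    have -> : ((m + m')%:~R + k%:R) / j%:R - e i
              = (m'%:~R + (k - i)%N%:R) / j%:R :> rat.
      rewrite natrB// rmorphD /e /=; field; exact: jn.
    by rewrite /fG laurent_funE.
  - by rewrite map_inj_uniq ?iota_uniq.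
  - by [].
  - move=> s _ sn; apply/eqP; apply: contraNT sn.
    rewrite mulf_eq0 negb_or => /andP[/(laurent_fun_supp j0)[i si]].
    move=> /(laurent_fun_supp j0)[i' si'].
    have ki : k = (i + i')%N.
      have /(congr1 (fun x => x * j%:R)) := si'.
      rewrite mulrBl si !divfK// rmorphD /= => ee.
      have : (k%:R : rat) = i%:R + i'%:R by lra.
      by rewrite -natrD => /eqP; rewrite eqr_nat => /eqP.
    rewrite si -[X in X \in _]/(e i) map_f// mem_iota add0n ltnS ki /=; exact: leq_addr.
rewrite fsbig1 => [|s _].
  have [->//|/(laurent_fun_supp j0)//] := eqVneq (laurent_fun j (m + m') (conv F G) r) 0.
apply/eqP; rewrite mulf_eq0; apply/norP => -[].
move=> /(laurent_fun_supp j0)[i si] /(laurent_fun_supp j0)[i' si'].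
apply: rn; exists (i + i')%N.
rewrite -[LHS](subrK s) si' {}si natrD rmorphD /=; field; exact: jn.
Qed.

Lemma conv_poly F G N k : (k < N)%N ->
  conv F G k = ((\poly_(i < N) F i) * (\poly_(i < N) G i))`_k.
Proof.
move=> kN; rewrite coefM; apply: eq_bigr => i _.
by rewrite !coef_poly !(leq_ltn_trans _ kN)// ?leq_subr// -ltnS.
Qed.

Lemma convC F G : conv F G = conv G F.
Proof. by apply/funext => k; rewrite !(@conv_poly _ _ k.+1)// mulrC. Qed.

Lemma conv_coef (p q : {poly K}) N k : (k < N)%N ->
  (forall i, (i < N)%N -> p`_i = q`_i) -> forall r, (p * r)`_k = (q * r)`_k.
Proof.
move=> kN pq r; rewrite !coefM; apply: eq_bigr => i _.
by rewrite pq// (leq_ltn_trans _ kN)// -ltnS.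
Qed.

Lemma convA F G H : conv F (conv G H) = conv (conv F G) H.
Proof.
apply/funext => k; rewrite !(@conv_poly _ _ k.+1)//.
set p := \poly_(i < _) F i; set q := \poly_(i < k.+1) G i.
set s := \poly_(i < k.+1) H i.
have e1 i : (i < k.+1)%N -> (\poly_(i < k.+1) conv G H i)`_i = (q * s)`_i.
  by move=> ik; rewrite coef_poly ik (conv_poly _ _ ik).
have e2 i : (i < k.+1)%N -> (\poly_(i < k.+1) conv F G i)`_i = (p * q)`_i.
  by move=> ik; rewrite coef_poly ik (conv_poly _ _ ik).
rewrite [in LHS]mulrC (conv_coef (ltnSn k) e1) (conv_coef (ltnSn k) e2).
by rewrite mulrC mulrA.
Qed.

Lemma convDl F G H : conv (F + G) H = conv F H + conv G H.
Proof.
apply/funext => k; rewrite -[RHS]big_split; apply: eq_bigr => i _.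
by rewrite [LHS]mulrDl.
Qed.

Definition conv1 : nat -> K := fun k => (k == 0%N)%:R.

Lemma conv1l F : conv conv1 F = F.
Proof.
apply/funext => k; rewrite /conv big_ord_recl /conv1 eqxx mul1r subn0.
by rewrite big1 ?addr0// => i _; rewrite mul0r.
Qed.

(* The first n coefficients of the inverse of sum_k F(k) X^k. *)
Fixpoint conv_inv_seq F n : seq K :=
  if n is n'.+1 then
    let s := conv_inv_seq F n' in
    rcons s ((F 0%N)^-1 *
      ((n' == 0%N)%:R - \sum_(i < n') F i.+1 * s`_(n' - i.+1)%N))
  else [::].

Lemma size_conv_inv_seq F n : size (conv_inv_seq F n) = n.
Proof. by elim: n => //= n IH; rewrite size_rcons IH. Qed.

Lemma nth_conv_inv_seq F n i : (i < n)%N ->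
  (conv_inv_seq F n)`_i = (conv_inv_seq F i.+1)`_i.
Proof.
elim: n => // n IH; rewrite ltnS leq_eqVlt => /predU1P[->//|lt_in].
by rewrite [in LHS]/= nth_rcons size_conv_inv_seq lt_in IH.
Qed.

Lemma conv_inv_ex F : F 0%N != 0 -> exists G, conv F G = conv1.
Proof.
move=> F0; exists (fun k => (conv_inv_seq F k.+1)`_k); apply/funext => k.
rewrite /conv big_ord_recl subn0 [X in F _ * X]/= nth_rcons size_conv_inv_seq.
rewrite ltnn eqxx mulrA divff// mul1r.
set S1 := \sum_(i < k) _; set S2 := \sum_(i < k) _; suff -> : S1 = S2.
  by rewrite subrK.
by apply: eq_bigr => i _; rewrite lift0 nth_conv_inv_seq// subnSK ?leq_subr.
Qed.

Lemma is_puiseux0 : is_puiseux 0.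
Proof. by exists 1%N, 0; split=> // r; rewrite eqxx. Qed.

Lemma is_puiseuxB f g : is_puiseux f -> is_puiseux g -> is_puiseux (f - g).
Proof.
move=> Pf Pg; have [j [m [F [G [_ [j0 -> -> _]]]]]] :=
  is_puiseux_common3 Pf Pg Pg.
exists j, m; split=> // r; have [f0|/(laurent_fun_supp j0)//] :=
  eqVneq (laurent_fun j m F r) 0.
have [g0|/(laurent_fun_supp j0)//] := eqVneq (laurent_fun j m G r) 0.
by rewrite !fctE f0 g0 subrr eqxx.
Qed.

Lemma is_puiseuxM f g :
  is_puiseux f -> is_puiseux g -> is_puiseux (puiseux_mul_fun f g).
Proof.
move=> Pf Pg; have [j [m [F [G [_ [j0 -> -> _]]]]]] :=
  is_puiseux_common3 Pf Pg Pg.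
by rewrite puiseux_mul_laurent//; apply: laurent_fun_puiseux.
Qed.

Definition puiseux_pred : {pred (rat -> K)} := fun f => `[< is_puiseux f >].

Fact puiseux_pred_zmod : zmod_closed puiseux_pred.
Proof.
split=> [|f g /asboolP Pf /asboolP Pg]; first exact/asboolP/is_puiseux0.
exact/asboolP/is_puiseuxB.
Qed.
HB.instance Definition _ :=
  GRing.isZmodClosed.Build _ puiseux_pred puiseux_pred_zmod.

(* Union over j >= 1 of the fields K((z^(1/j))): an element is given by its
   coefficients f(r), r rational, and stands for the sum of the f(r) z^r.
   [pcoef] is not a coercion: functions [rat -> K] have a pointwise product. *)
Record puiseux := Puiseux {
  pcoef : rat -> K;
  pcoef_puiseux : pcoef \in puiseux_pred
}.

HB.instance Definition _ := [isSub for pcoef].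
HB.instance Definition _ := [Choice of puiseux by <:].
HB.instance Definition _ := [SubChoice_isSubZmodule of puiseux by <:].

Definition mk_puiseux f (Pf : is_puiseux f) : puiseux :=
  Puiseux (asboolT Pf : f \in puiseux_pred).

Lemma puiseuxP (f : puiseux) : is_puiseux (pcoef f).
Proof. exact/asboolP/(pcoef_puiseux f). Qed.

Lemma pcoef_inj : injective pcoef.
Proof. exact: val_inj. Qed.

Definition puiseux_mul (f g : puiseux) : puiseux :=
  mk_puiseux (is_puiseuxM (puiseuxP f) (puiseuxP g)).

(* The monomial c z^r. *)
Definition monom_fun (c : K) (r : rat) : rat -> K :=
  fun s => if s == r then c else 0.

Lemma monom_funE c r j m : (0 < j)%N -> r = m%:~R / j%:R ->
  monom_fun c r = laurent_fun j m (fun k => if k == 0%N then c else 0).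
Proof.
move=> j0 ->; have jn := natrat_neq0 j0.
have sp : puiseux_supp j m (monom_fun c (m%:~R / j%:R)).
  move=> s; rewrite /monom_fun.
  have [->|] := eqVneq s (m%:~R / j%:R); last by rewrite eqxx.
  by exists 0%N; rewrite addr0.
rewrite {1}(puiseux_suppE j0 sp); congr laurent_fun; apply/funext => k.
rewrite /monom_fun; congr (if _ then _ else _).
by rewrite (inj_eq (mulIf _)) ?invr_eq0// -subr_eq0 addrC addKr pnatr_eq0.
Qed.

Lemma monom_fun_puiseux c r : is_puiseux (monom_fun c r).
Proof.
rewrite (@monom_funE _ _ `|denq r| (numq r)) ?absz_gt0 ?denq_eq0//.
  by apply: laurent_fun_puiseux; rewrite absz_gt0 denq_eq0.
by rewrite natr_absz ger0_norm ?denq_ge0// divq_num_den.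
Qed.

Definition pmonom (c : K) (r : rat) : puiseux :=
  mk_puiseux (monom_fun_puiseux c r).

Fact puiseux_mulA : associative puiseux_mul.
Proof.
move=> f g h; apply/val_inj => /=.
have [j [m [F [G [H [j0 -> -> ->]]]]]] :=
  is_puiseux_common3 (puiseuxP f) (puiseuxP g) (puiseuxP h).
by rewrite !puiseux_mul_laurent// convA addrA.
Qed.

Fact puiseux_mulC : commutative puiseux_mul.
Proof.
move=> f g; apply/val_inj => /=.
have [j [m [F [G [_ [j0 -> -> _]]]]]] :=
  is_puiseux_common3 (puiseuxP f) (puiseuxP g) (puiseuxP g).
by rewrite !puiseux_mul_laurent// convC.
Qed.

Fact puiseux_mul1 : left_id (pmonom 1 0) puiseux_mul.
Proof.
move=> f; apply/val_inj => /=.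
have [j [m [F [_ [_ [j0 -> _ _]]]]]] :=
  is_puiseux_common3 (puiseuxP f) (puiseuxP f) (puiseuxP f).
rewrite (@monom_funE _ _ j 0)// ?mul0r// puiseux_mul_laurent// add0r.
rewrite -[in RHS](conv1l F); congr (laurent_fun _ _ (conv _ _)).
by apply/funext => k; rewrite /conv1; case: eqP.
Qed.

Lemma laurent_funD j m F G :
  laurent_fun j m (F + G) = laurent_fun j m F + laurent_fun j m G.
Proof.
apply/funext => r; rewrite -[RHS]/(laurent_fun j m F r + laurent_fun j m G r).
rewrite /laurent_fun /=.
by case: ifP => _; rewrite ?addr0.
Qed.

Fact puiseux_mulDl : left_distributive puiseux_mul +%R.
Proof.
move=> f g h; apply/val_inj.
change (puiseux_mul_fun (pcoef f + pcoef g) (pcoef h) =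
  puiseux_mul_fun (pcoef f) (pcoef h) + puiseux_mul_fun (pcoef g) (pcoef h)).
have [j [m [F [G [H [j0 -> -> ->]]]]]] :=
  is_puiseux_common3 (puiseuxP f) (puiseuxP g) (puiseuxP h).
by rewrite -laurent_funD !puiseux_mul_laurent// convDl laurent_funD.
Qed.

Fact puiseux_1neq0 : pmonom 1 0 != 0.
Proof.
apply/eqP => /(congr1 (fun f : puiseux => pcoef f 0)) /=.
rewrite /monom_fun eqxx => /eqP; exact/negP/oner_neq0.
Qed.

HB.instance Definition _ := GRing.Zmodule_isComNzRing.Build puiseux
  puiseux_mulA puiseux_mulC puiseux_mul1 puiseux_mulDl puiseux_1neq0.

Lemma puiseux_inv_ex (f : puiseux) : f != 0 -> exists g : puiseux, g * f = 1.
Proof.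
move=> fn0.
have [j [m [F [_ [_ [j0 fF _ _]]]]]] :=
  is_puiseux_common3 (puiseuxP f) (puiseuxP f) (puiseuxP f).
have exF : exists k, F k != 0.
  apply: contrapT => /forallNP F0; case/eqP: fn0; apply/pcoef_inj => /=.
  rewrite fF; apply/funext => r; rewrite /laurent_fun; case: ifP => // _.
  exact/eqP/negPn/negP/F0.
have [k Fk min_k] := ex_minnP exF.
have sf : puiseux_supp j (m + k%:Z) (pcoef f).
  rewrite fF => r; rewrite /laurent_fun; case: ifPn => [xN Fx|]; last first.
    by rewrite eqxx.
  have kx := min_k _ Fx; exists (Num.truncn (r * j%:R - m%:~R) - k)%N.
  rewrite natrB// truncnK// rmorphD /=; have jn := natrat_neq0 j0.
  by field; exact: jn.
have := puiseux_suppE j0 sf; set G := fun i : nat => _ => fG.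
have G0 : G 0%N != 0.
  by rewrite /G addr0 fF rmorphD /= laurent_funE.
have [H GH] := conv_inv_ex G0.
exists (mk_puiseux (laurent_fun_puiseux (- (m + k%:Z)) H j0)).
apply/pcoef_inj; change (puiseux_mul_fun (laurent_fun j (- (m + k%:Z)) H) (pcoef f)
  = monom_fun 1 0).
rewrite fG puiseux_mul_laurent// addrC subrr convC GH.
rewrite (@monom_funE _ _ j 0)// ?mul0r//; congr laurent_fun.
by apply/funext => i; rewrite /conv1; case: eqP.
Qed.

Definition puiseux_inv (f : puiseux) : puiseux := xget 0 [set g : puiseux | g * f = 1].

Fact puiseux_mulVx (f : puiseux) : f != 0 -> puiseux_inv f * f = 1.
Proof.
by move=> /puiseux_inv_ex[g gf]; exact: (@xgetPex _ 0 [set h : puiseux | h * f = 1]) (ex_intro _ g gf).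
Qed.

Fact puiseux_inv0 : puiseux_inv 0 = 0.
Proof.
apply: xgetPN => g /=; rewrite mulr0 => /esym/eqP.
exact/negP/oner_neq0.
Qed.

HB.instance Definition _ := GRing.ComNzRing_isField.Build puiseux
  puiseux_mulVx puiseux_inv0.


Definition power_series (u : nat -> K) : puiseux :=
  mk_puiseux (laurent_fun_puiseux 0 u (ltn0Sn 0)).

Lemma pcoef_power_series u (r : rat) : pcoef (power_series u) r =
  if r \is a Num.nat then u (Num.truncn r) else 0.
Proof. by rewrite /= /laurent_fun mulr1 subr0. Qed.

Definition puiseux_poly (j : nat) (p : {poly K}) : puiseux :=
  \sum_(i < size p) pmonom p`_i (i%:R / j%:R).

(* The subfield K(z^{1/oo}), union over j >= 1 of the fields K(z^(1/j)). *)
Definition puiseux_ratfun : set puiseux :=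
  [set f | exists (j : nat) (p q : {poly K}),
    [/\ (0 < j)%N, q != 0 & f = puiseux_poly j p / puiseux_poly j q]].

(* Systems of roots q_j of q, the entry at j = 0 being irrelevant. *)
Definition compatible_roots (q : K) (qs : nat -> K) :=
  (forall j, (0 < j)%N -> qs j ^+ j = q) /\
  (forall j k l, (0 < j)%N -> j = (l * k)%N -> qs j ^+ l = qs k).

(* z^r, r = n/d in lowest terms, is mapped to (q_d)^n z^r. *)
Definition sigma_weight (qs : nat -> K) (r : rat) : K :=
  qs `|denq r|%N ^ numq r.

Lemma sigma_puiseux (qs : nat -> K) (f : puiseux) :
  is_puiseux (fun r => sigma_weight qs r * pcoef f r).
Proof.
have [j [m [j0 sf]]] := puiseuxP f; exists j, m; split=> // r.
by rewrite mulf_eq0 negb_or => /andP[_ /sf].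
Qed.

Definition sigma (qs : nat -> K) (f : puiseux) : puiseux :=
  mk_puiseux (sigma_puiseux qs f).

Section Sigma.
Variables (q : K) (qs : nat -> K).
Hypotheses (q0 : q != 0) (qsP : compatible_roots q qs).

Lemma qs_neq0 j : (0 < j)%N -> qs j != 0.
Proof.
move=> j0; apply: contraNneq q0 => qj0.
by rewrite -(qsP.1 j j0) qj0 expr0n eqn0Ngt j0.
Qed.

Lemma sigma_weightE (k : int) (j : nat) : (0 < j)%N ->
  sigma_weight qs (k%:~R / j%:R) = qs j ^ k.
Proof.
move=> j0; rewrite /sigma_weight; set r := _ / _.
have d0 : (0 < `|denq r|)%N by rewrite absz_gt0 denq_eq0.
have N0 : (0 < j * `|denq r|)%N by rewrite muln_gt0 j0.
rewrite -(qsP.2 _ _ j N0 erefl) -(qsP.2 _ j `|denq r|%N N0 (mulnC _ _)).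
rewrite !exprnP !exprz_exp; congr (_ ^ _).
have jn := natrat_neq0 j0.
have : (numq r)%:~R * j%:R = k%:~R * (denq r)%:~R :> rat.
  have /eqP : (numq r)%:~R / (denq r)%:~R = r by rewrite divq_num_den.
  rewrite /r eqr_div ?intr_eq0 ?denq_eq0//.
  by rewrite -/r => /eqP ->.
rewrite -[j%:R]/((j : int)%:~R) -!rmorphM /= => /eqP; rewrite eqr_int => /eqP.
rewrite [in LHS]mulrC => ->; rewrite mulrC absz_denq.
by [].
Qed.

Lemma sigma_weightD r s :
  sigma_weight qs (r + s) = sigma_weight qs r * sigma_weight qs s.
Proof.
have dP x : (0 < `|denq x|)%N by rewrite absz_gt0 denq_eq0.
pose N := (`|denq r| * `|denq s|)%N.
have N0 : (0 < N)%N by rewrite muln_gt0 !dP.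
have nE x : x = (numq x)%:~R / `|denq x|%N%:R.
  by rewrite natr_absz ger0_norm ?denq_ge0// divq_num_den.
have rE : r = (numq r * `|denq s|%N%:Z)%:~R / N%:R.
  by rewrite [LHS]nE /N natrM rmorphM /=; field; rewrite !natrat_neq0.
have sE : s = (numq s * `|denq r|%N%:Z)%:~R / N%:R.
  by rewrite [LHS]nE /N natrM rmorphM /=; field; rewrite !natrat_neq0.
rewrite rE sE -mulrDl -rmorphD !sigma_weightE//.
by rewrite expfzDr// qs_neq0.
Qed.

Lemma sigmaD : {morph sigma qs : f g / f + g}.
Proof.
by move=> f g; apply/pcoef_inj/funext => r; exact: mulrDr.
Qed.

Lemma sigma_monom c r :
  sigma qs (pmonom c r) = pmonom (sigma_weight qs r * c) r.
Proof.
apply/pcoef_inj/funext => s /=; rewrite /monom_fun.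
by case: eqP => [->//|]; rewrite mulr0.
Qed.

Lemma sigma_root j : (0 < j)%N ->
  sigma qs (pmonom 1 j%:R^-1) = pmonom (qs j) 0 * pmonom 1 j%:R^-1.
Proof.
move=> j0; rewrite sigma_monom mulr1 -[X in sigma_weight _ X]mul1r.
rewrite -[1]/(1%:~R) sigma_weightE// expr1z; apply/pcoef_inj.
change (monom_fun (qs j) j%:R^-1 =
  puiseux_mul_fun (monom_fun (qs j) 0) (monom_fun 1 j%:R^-1)).
rewrite (@monom_funE _ _ j 1) ?mul1r// (@monom_funE _ 0 j 0) ?mul0r//.
rewrite (@monom_funE _ _ j 1) ?mul1r// puiseux_mul_laurent// add0r.
congr laurent_fun; apply/funext => k; rewrite /conv big_ord_recl subn0 /=.
rewrite big1 ?addr0 => [|i _]; last by rewrite mul0r.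
by case: eqP; rewrite ?mulr0 ?mulr1.
Qed.

Lemma sigma1 : sigma qs 1 = 1.
Proof.
rewrite [LHS]sigma_monom mulr1 -[0 : rat](mul0r (1%N%:R^-1)).
by rewrite -[0]/(0%:~R) sigma_weightE// expr0z.
Qed.

Lemma sigma_laurent j m F : (0 < j)%N ->
  (fun r => sigma_weight qs r * laurent_fun j m F r) =
  laurent_fun j m (fun k => qs j ^ (m + k%:Z) * F k).
Proof.
move=> j0.
have sp : puiseux_supp j m (fun r => sigma_weight qs r * laurent_fun j m F r).
  move=> r; rewrite mulf_eq0 negb_or => /andP[_].
  exact: (@laurent_fun_supp j m F).
rewrite (puiseux_suppE j0 sp); congr laurent_fun; apply/funext => k.
rewrite laurent_funE//; congr (_ * _).
by rewrite -[k%:R]/((k : int)%:~R) -rmorphD sigma_weightE.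
Qed.

Lemma sigmaM : {morph sigma qs : f g / f * g}.
Proof.
move=> f g; apply/pcoef_inj.
change ((fun r => sigma_weight qs r * puiseux_mul_fun (pcoef f) (pcoef g) r) =
  puiseux_mul_fun (fun r => sigma_weight qs r * pcoef f r)
                  (fun r => sigma_weight qs r * pcoef g r)).
have [j [m [F [G [_ [j0 -> -> _]]]]]] :=
  is_puiseux_common3 (puiseuxP f) (puiseuxP g) (puiseuxP g).
rewrite puiseux_mul_laurent// !sigma_laurent// puiseux_mul_laurent//.
congr laurent_fun; apply/funext => k; rewrite /conv mulr_sumr.
apply: eq_bigr => i _; rewrite mulrACA -expfzDr ?qs_neq0//.
congr (_ ^ _ * _); have := ltn_ord i; lia.
Qed.

Lemma sigma_bij : bijective (sigma qs).
Proof.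
have w0 r : sigma_weight qs r != 0.
  by rewrite expfz_neq0// qs_neq0// absz_gt0 denq_eq0.
have wV r : sigma_weight (fun j => (qs j)^-1) r = (sigma_weight qs r)^-1.
  by rewrite /sigma_weight exprz_inv invr_expz.
exists (sigma (fun j => (qs j)^-1)) => f; apply/pcoef_inj/funext => r /=.
  by rewrite wV mulKf.
by rewrite wV mulVKf.
Qed.

Lemma sigma_power_series u :
  sigma qs (power_series u) = power_series (fun k => q ^+ k * u k).
Proof.
apply/pcoef_inj.
change ((fun r => sigma_weight qs r * laurent_fun 1 0 u r) =
  laurent_fun 1 0 (fun k => q ^+ k * u k)).
rewrite sigma_laurent//; congr laurent_fun; apply/funext => k.
by rewrite -(qsP.1 1%N isT) expr1 add0r.
Qed.

End Sigma.

End PuiseuxFun.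

(* The x_0, x_1, x_2, etc. are algebraically independent over the subset F. *)
Definition alg_independent (L : fieldType) (F : set L) (x : nat -> L) :=
  forall (n : nat) (P : mpoly n L),
    (forall e, F (mcoeff e P)) ->
    meval (fun i : 'I_n => x i) P = 0 -> P = 0.

Definition sigma_transcendental (K : fieldType) (qs : nat -> K)
    (f : puiseux K) :=
  alg_independent (@puiseux_ratfun K) (fun i => iter i (sigma qs) f).

(* 'M[K]_n with the Zariski topology; an alias, since 'M[K]_n may inherit
   another topology from K. *)
Definition zariski_mx (K : fieldType) (n : nat) : Type := 'M[K]_n.

Section Zariski.
Variables (K : fieldType) (n : nat).

HB.instance Definition _ := Choice.copy (zariski_mx K n) 'M[K]_n.

Definition entry_eval (P : mpoly (n * n) K) (A : 'M[K]_n) : K :=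
  meval (fun k => mxvec A 0 k) P.

Definition zariski_closed (Z : set (zariski_mx K n)) :=
  exists S : set (mpoly (n * n) K),
    Z = [set A | forall P, S P -> entry_eval P A = 0].

Definition zariski_open (U : set (zariski_mx K n)) := zariski_closed (~` U).

Fact zariski_openT : zariski_open setT.
Proof.
exists [set 1]; rewrite setCT; apply/esym/seteqP; split=> // A /(_ 1 erefl).
by rewrite /entry_eval rmorph1 => /eqP; rewrite oner_eq0.
Qed.

Fact zariski_openI : setI_closed zariski_open.
Proof.
move=> U V [S US] [T VT].
exists [set R | exists P Q, [/\ S P, T Q & R = P * Q]].
rewrite setCI US VT; apply/seteqP; split=> A /=.
  move=> [AS|AT] _ [P [Q [SP TQ ->]]]; rewrite /entry_eval rmorphM /=.
    by rewrite -/(entry_eval P A) AS// mul0r.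
  by rewrite -/(entry_eval Q A) AT// mulr0.
move=> AST; have [AS|] := pselect (forall P, S P -> entry_eval P A = 0).
  by left.
move=> /existsNP[P /not_implyP[SP /eqP PA]]; right=> Q TQ.
have := AST (P * Q) (ex_intro _ P (ex_intro _ Q (And3 SP TQ erefl))).
by rewrite /entry_eval rmorphM /= => /eqP; rewrite mulf_eq0 (negPf PA) => /eqP.
Qed.

Fact zariski_open_bigU (I : Type) (f : I -> set (zariski_mx K n)) :
  (forall i, zariski_open (f i)) -> zariski_open (\bigcup_i f i).
Proof.
move=> fo; have [S fS] := choice fo.
exists (\bigcup_i S i); rewrite setC_bigcup; apply/seteqP; split=> A /= fA.
  by move=> P [i _ SP]; have := fA i Logic.I; rewrite fS; exact.
by move=> i _; rewrite fS => P SP; apply: fA; exists i.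
Qed.

HB.instance Definition _ := isOpenTopological.Build (zariski_mx K n)
  zariski_openT zariski_openI zariski_open_bigU.

Lemma closed_zariskiE (Z : set (zariski_mx K n)) : closed Z = zariski_closed Z.
Proof. by rewrite -openC -[in RHS](setCK Z). Qed.

Definition gl_subgroup (G : set 'M[K]_n) :=
  [/\ G `<=` [set A | A \in unitmx], G 1%:M,
      forall A B, G A -> G B -> G (A *m B) & forall A, G A -> G (invmx A)].

Definition gl_generated (A : 'M[K]_n) : set 'M[K]_n :=
  smallest gl_subgroup [set A].

(* The closure in GL_n(K), which carries the topology induced by 'M[K]_n. *)
Definition alg_group_generated (A : 'M[K]_n) : set (zariski_mx K n) :=
  closure (gl_generated A : set (zariski_mx K n)) `&` [set B | B \in unitmx].

End Zariski.

Section Hypergeometric.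
Variable R : realType.
Implicit Types (q a : R[i]).

Definition cexp (x : R[i]) : R[i] :=
  Complex (expR (complex.Re x) * cos (complex.Im x))
          (expR (complex.Re x) * sin (complex.Im x)).

Lemma cexpD x y : cexp (x + y) = cexp x * cexp y.
Proof.
case: x y => [x1 x2] [y1 y2]; apply/eqP; rewrite eq_complex /=.
by rewrite expRD cosD sinD; apply/andP; split; apply/eqP; ring.
Qed.

(* q^alpha = exp (alpha log q), for the determination logq of log q. *)
Definition qpow (logq alpha : R[i]) : R[i] := cexp (alpha * logq).

Definition qpow_real (logq : R[i]) : set R[i] :=
  [set x | exists t : R, x = qpow logq t%:C%C].

Definition qpow_negnat (q : R[i]) : set R[i] :=
  [set x | exists m : nat, x = q ^- m].

Definition qpochhammer (a q : R[i]) (m : nat) : R[i] :=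
  \prod_(k < m) (1 - a * q ^+ k).

Definition basic_hypergeometric (n s : nat) (a : 'I_n -> R[i])
    (b : 'I_s -> R[i]) (lambda q : R[i]) : puiseux R[i] :=
  power_series (fun m => (\prod_i qpochhammer (a i) q m) /
                         (\prod_j qpochhammer (b j) q m) * lambda ^+ m).

End Hypergeometric.

(* Main.v *)
(* The series f has simple poles on the spiral q^-N / lambda and no other poles,
   so by multiplicative independence f(qq^N z) has poles along the spiral
   S = qq^-N q^-N / lambda, where f(z), ..., f(qq^(N-1) z) are regular. In a
   relation sum_d Phi_d f(qq^N z)^d = 0, with coefficients Phi_d in the algebra
   generated by f(z), ..., f(qq^(N-1) z), the leading Phi_D therefore vanishes at
   almost all points of S. As n > s, the q-difference equation of f can be solved
   for f(q^n z) over C[z, 1/z], hence all Phi_D(q^L z) lie in a finitely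
   generated C[z, 1/z]-module, and a fixed nonzero multiple of each is a
   combination of finitely many of them: the zeros of Phi_D propagate along S down
   to 0. Being convergent at 0, Phi_D is zero, and one concludes by induction on N.

   The residue of f at q^-k / lambda is a constant multiple of the coefficient u_k
   of the solution u of B(x) u(qx) = A(x) u(x), where A = prod (1 - a_i x) and
   B = prod (1 - b_j x), because the coefficients of f are, up to a constant, the
   lambda^m u(q^m). As the a_i are real powers of q, u has a single pole on its
   circle of convergence, so that u_k is nonzero for large k.

   Analytic functions are replaced by series that converge on some disc, and "w
   vanishes at x" by divisibility by t - x. *)
From HB Require Import structures.
Require Import Defs.
From mathcomp Require Import all_boot all_order all_algebra.
From mathcomp Require Import all_classical all_reals all_analysis.
From mathcomp Require Import complex.
From mathcomp Require Import ring lra zify.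
From mathcomp.multinomials Require Import -(notations) mpoly.

Import Order.TTheory GRing.Theory Num.Theory.
Local Open Scope classical_set_scope.
Local Open Scope ring_scope.

Set Implicit Arguments.
Unset Strict Implicit.
Unset Printing Implicit Defensive.

(** * Series and polynomials in a root of z *)

Section Series.
Variables (K : fieldType) (j : nat).
Implicit Types (u v : nat -> K) (P Q : {poly K}).

(* The series sum_k u(k) t^k, where t = z^(1/(j+1)). *)
Definition ser u : puiseux K := mk_puiseux (laurent_fun_puiseux 0 u (ltn0Sn j)).

Lemma pcoef_ser u k : pcoef (ser u) (k%:R / j.+1%:R) = u k.
Proof. by have := laurent_funE 0 u k (ltn0Sn j); rewrite add0r. Qed.

Lemma ser_inj : injective ser.
Proof.
by move=> u v uv; apply/funext => k; rewrite -[u k]pcoef_ser uv pcoef_ser.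
Qed.

Lemma serD u v : ser (u + v) = ser u + ser v.
Proof. by apply/pcoef_inj; exact: laurent_funD. Qed.

Lemma ser0 : ser 0 = 0.
Proof. by apply: (addrI (ser 0)); rewrite -serD !addr0. Qed.

Lemma serN u : ser (- u) = - ser u.
Proof. by apply: (addrI (ser u)); rewrite -serD !subrr ser0. Qed.

Lemma serM u v : ser (Defs.conv u v) = ser u * ser v.
Proof.
apply/pcoef_inj.
by rewrite [RHS](puiseux_mul_laurent 0 0 u v (ltn0Sn j)) addr0.
Qed.

(** A nonzero idempotent of a field is 1, so the neutrality of [conv1] for convolution is enough. *)
Lemma ser1 : ser (@Defs.conv1 K) = 1.
Proof.
have idem : ser (@Defs.conv1 K) * ser (@Defs.conv1 K) = ser (@Defs.conv1 K).
  by rewrite -serM conv1l.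
apply: (mulfI (_ : ser (@Defs.conv1 K) != 0)); last by rewrite idem mulr1.
apply/eqP; rewrite -ser0 => /ser_inj/(congr1 (@^~ 0%N)) /eqP.
by rewrite /Defs.conv1 eqxx oner_eq0.
Qed.

(** This is P(t) for t = z^(1/(j+1)); multiplication by [pt P] plays the role of scalar
    multiplication over K[t]. *)
Definition pt P : puiseux K := ser (fun k => P`_k).

Fact pt_is_zmod : zmod_morphism pt.
Proof.
move=> P Q; rewrite /pt -serN -serD; congr ser; apply/funext => k.
by rewrite coefB.
Qed.

Fact pt_is_monoid : monoid_morphism pt.
Proof.
split=> [|P Q]; rewrite /pt -?ser1 -?serM; congr ser; apply/funext => k.
  by rewrite coef1.
by rewrite coefM.
Qed.

HB.instance Definition _ := GRing.isZmodMorphism.Build _ _ pt pt_is_zmod.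
HB.instance Definition _ := GRing.isMonoidMorphism.Build _ _ pt pt_is_monoid.

Lemma pt_inj : injective pt.
Proof.
move=> P Q /ser_inj PQ; apply/polyP => k.
exact: (congr1 (@^~ k) PQ).
Qed.

Lemma pt_eq0 P : (pt P == 0) = (P == 0).
Proof. by rewrite -(rmorph0 pt) (inj_eq pt_inj). Qed.

Lemma convXn_coef u d k : Defs.conv (fun i => ('X^d : {poly K})`_i) u k =
  if (k < d)%N then 0 else u (k - d)%N.
Proof.
transitivity ('X^d * \poly_(i < k.+1) u i)`_k.
  rewrite coefM; apply: eq_bigr => i _.
  by rewrite coef_poly ltnS leq_subr.
rewrite coefXnM coef_poly; case: ifP => // kd.
by rewrite ltnS leq_subr.
Qed.

Lemma convC_coef c u k : Defs.conv (fun i => (c%:P : {poly K})`_i) u k = c * u k.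
Proof.
rewrite /Defs.conv big_ord_recl coefC eqxx subn0 big1 ?addr0// => i _.
by rewrite coefC mul0r.
Qed.

Lemma pt_C_ser c u : pt c%:P * ser u = ser (fun k => c * u k).
Proof. by rewrite -serM; congr ser; apply/funext => k; rewrite convC_coef. Qed.

Lemma pt_Xn_ser d u : pt 'X^d * ser u =
  ser (fun k => if (k < d)%N then 0 else u (k - d)%N).
Proof. by rewrite -serM; congr ser; apply/funext => k; rewrite convXn_coef. Qed.

End Series.

Section Widen.
Variables (K : fieldType).
Implicit Types (u v : nat -> K) (P Q : {poly K}).

(** The coefficients of u(t^(j+1)), where t^(j+1) = z. *)
Definition widen_seq j u : nat -> K :=
  fun k => if (j.+1 %| k)%N then u (k %/ j.+1)%N else 0.

Lemma ser_widen j u : ser 0 u = ser j (widen_seq j u).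
Proof.
apply/pcoef_inj/(puiseux_supp_ext (j := j.+1) (m := 0)).
- rewrite -[j.+1]mul1n.
  by apply: (puiseux_supp_widen (m := 0)) => //; exact: laurent_fun_supp.
- exact: laurent_fun_supp.
move=> k; rewrite add0r pcoef_ser /widen_seq.
rewrite pcoef_power_series; case: (boolP (j.+1 %| k)%N) => [/dvdnP[i ->]|jk].
  by rewrite natrM mulfK ?pnatr_eq0// natr_nat natrK mulnK.
case: ifPn => // /natrP[i ki]; case/negP: jk.
have /eqP : (k%:R : rat) = (i * j.+1)%:R by rewrite natrM -ki divfK ?pnatr_eq0.
by rewrite eqr_nat => /eqP ->; rewrite dvdn_mull.
Qed.

Lemma pt_widen j P : pt 0 P = pt j (P \Po 'X^(j.+1)).
Proof.
rewrite /pt (ser_widen j); congr ser; apply/funext => k.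
by rewrite /widen_seq coef_comp_poly_Xn.
Qed.

Lemma pt_monom j (c : K) i : pt j (c *: 'X^i) = pmonom c (i%:R / j.+1%:R).
Proof.
apply/pcoef_inj; apply: (puiseux_supp_ext (j := j.+1) (m := 0)).
- exact: laurent_fun_supp.
- move=> r /=; rewrite /monom_fun.
  have [-> _|_ /eqP//] := eqVneq r (i%:R / j.+1%:R).
  by exists i; rewrite add0r.
move=> k; rewrite add0r pcoef_ser /= /monom_fun coefZ coefXn.
rewrite (inj_eq (mulIf _)) ?invr_eq0 ?pnatr_eq0// eqr_nat.
by case: eqP; rewrite ?mulr1 ?mulr0.
Qed.

Lemma pt_puiseux_poly j P : puiseux_poly j.+1 P = pt j P.
Proof.
rewrite -[in RHS](coefK P) poly_def raddf_sum /puiseux_poly.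
by apply: eq_bigr => i _; rewrite /= pt_monom.
Qed.

End Widen.

(** * Clearing denominators in fractional powers of z *)

Section Denominators.
Variable K : fieldType.
Local Notation L := (puiseux K).
Implicit Types (P Q : {poly K}).

Lemma pt_level j j' l P : j'.+1 = (j.+1 * l)%N ->
  pt j P = pt j' (P \Po 'X^l).
Proof.
move=> jE; have l0 : (0 < l)%N by move: jE; case: l => //; rewrite muln0.
rewrite -[P in LHS]coefK poly_def comp_polyE !raddf_sum /=.
apply: eq_bigr => i _; rewrite -exprM !pt_monom jE !natrM; congr pmonom.
by rewrite [X in _ = _ / X]mulrC -mulf_div divff ?mul1r// pnatr_eq0 -lt0n.
Qed.

Lemma puiseux_ratfunP (w : L) : puiseux_ratfun w ->
  exists j Q, Q != 0 /\ exists P, pt j Q * w = pt j P.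
Proof.
move=> [j [P [Q [j0 Q0 ->]]]]; exists j.-1, Q; split=> //; exists P.
by rewrite -{2 3}(prednK j0) !pt_puiseux_poly mulrCA divff ?mulr1// pt_eq0.
Qed.

Lemma pt_ratfun j P : puiseux_ratfun (pt j P).
Proof.
exists j.+1, P, 1; split=> //; first exact: oner_neq0.
by rewrite !pt_puiseux_poly rmorph1 divr1.
Qed.

(** Reduces an algebraic relation to one whose coefficients are polynomials in a single root of z.
    Roots of orders j1+1 and j2+1 are both powers of a root of order (j1+1)(j2+1). *)
Lemma common_denominator (s : seq L) : (forall w, w \in s -> puiseux_ratfun w) ->
  exists j Q, Q != 0 /\ forall w, w \in s -> exists P, pt j Q * w = pt j P.
Proof.
elim: s => [|w s IH] hs; first by exists 0%N, 1; rewrite oner_neq0.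
have [|j1 [Q1 [Q10 h1]]] := IH; first by move=> v vs; apply: hs; rewrite in_cons vs orbT.
have [j2 [Q2 [Q20 [P2 h2]]]] := puiseux_ratfunP (hs w (mem_head _ _)).
pose j := (j1.+1 * j2.+1).-1.
have jE1 : j.+1 = (j1.+1 * j2.+1)%N by rewrite prednK// muln_gt0.
have jE2 : j.+1 = (j2.+1 * j1.+1)%N by rewrite jE1 mulnC.
have XC P l : (0 < l)%N -> P != 0 -> P \Po 'X^l != 0.
  by move=> l0; apply: contra_neq => /eqP; rewrite comp_poly_eq0 ?size_polyXn// => /eqP.
exists j, ((Q1 \Po 'X^(j2.+1)) * (Q2 \Po 'X^(j1.+1))); split.
  by rewrite mulf_neq0// XC.
move=> v; rewrite in_cons rmorphM /= -(pt_level _ jE1) -(pt_level _ jE2).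
move=> /predU1P[->|/h1[P hP]].
  exists ((Q1 \Po 'X^(j2.+1)) * (P2 \Po 'X^(j1.+1))).
  by rewrite rmorphM /= -(pt_level _ jE1) -(pt_level _ jE2) -mulrA h2.
exists ((P \Po 'X^(j2.+1)) * (Q2 \Po 'X^(j1.+1))).
by rewrite rmorphM /= -(pt_level _ jE1) -(pt_level _ jE2) -hP mulrAC.
Qed.

End Denominators.

(** * Multivariate polynomials as polynomials in the last variable *)

Section LastVariable.
Variables (L : fieldType) (N : nat).

Definition restr_mnm (m : multinom N.+1) : multinom N :=
  Multinom [tuple m (widen_ord (leqnSn N) i) | i < N].

Lemma restr_mnmE m i : restr_mnm m i = m (widen_ord (leqnSn N) i).
Proof. exact: mnmE. Qed.

Lemma restr_mnm_inj m m' : restr_mnm m = restr_mnm m' ->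
  m ord_max = m' ord_max -> m = m'.
Proof.
move=> rm mm; apply/mnmP => i; have [iN|] := ltnP i N.
  have -> : i = widen_ord (leqnSn N) (Ordinal iN) by exact/val_inj.
  by rewrite -!restr_mnmE rm.
move=> Ni; suff -> : i = ord_max by [].
by apply/val_inj/eqP; rewrite eqn_leq -ltnS ltn_ord.
Qed.

Definition last_coef (P : mpoly N.+1 L) (d : nat) : mpoly N L :=
  \sum_(m <- msupp P | m ord_max == d) mcoeff m P *: mpolyX L (restr_mnm m).

Lemma last_coef_eq0 P : (forall d, last_coef P d = 0) -> P = 0.
Proof.
move=> P0; apply/mpolyP => m; rewrite mcoeff0.
have [mP|] := boolP (m \in msupp P); last exact: memN_msupp_eq0.
have /(congr1 (mcoeff (restr_mnm m))) := P0 (m ord_max).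
rewrite /last_coef raddf_sum /= mcoeff0 -big_filter.
rewrite (bigD1_seq m) ?mem_filter ?eqxx ?filter_uniq ?msupp_uniq//=.
rewrite mcoeffZ mcoeffX eqxx mulr1 big_seq_cond big1 ?addr0// => m'.
rewrite mem_filter mcoeffZ mcoeffX => /andP[/andP[/eqP mm' _] m'm].
case: eqP => [rm|]; last by rewrite mulr0.
by rewrite (restr_mnm_inj rm mm') eqxx in m'm.
Qed.

(** Any large enough number of terms is allowed, so that the range can later be stretched to contain
    a prescribed degree. *)
Lemma meval_last_coef (x : nat -> L) P : exists D, forall D', (D <= D')%N ->
  meval (fun i : 'I_N.+1 => x i) P =
  \sum_(d < D') meval (fun i : 'I_N => x i) (last_coef P d) * x N ^+ d.
Proof.
exists (\max_(m <- msupp P) m ord_max).+1 => D' DD'.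
rewrite mevalE; pose F m := mcoeff m P * \prod_(i < N.+1) x i ^+ m i.
have FE m : F m = mcoeff m P * meval (fun i : 'I_N => x i) (mpolyX L (restr_mnm m))
    * x N ^+ m ord_max.
  rewrite /F big_ord_recr /= mulrA mevalX; congr (_ * _ * _).
  by apply: eq_bigr => i _; rewrite restr_mnmE.
rewrite [LHS](_ : _ = \sum_(m <- msupp P) F m)//.
transitivity (\sum_(d < D') \sum_(m <- msupp P | m ord_max == d :> nat) F m).
  rewrite (exchange_big_dep predT)//= big_seq [RHS]big_seq; apply: eq_bigr => m mP.
  have mD : (m ord_max < D')%N.
    apply: leq_trans DD'; rewrite ltnS.
    by apply: (@leq_bigmax_seq _ (msupp P) xpredT (fun m : multinom N.+1 => m ord_max)).
  rewrite (bigD1 (Ordinal mD))//= big1 ?addr0// => d /andP[/eqP md].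
  by rewrite -val_eqE /= md eqxx.
apply: eq_bigr => d _; rewrite /last_coef raddf_sum /= mulr_suml.
by apply: eq_bigr => m /eqP md; rewrite FE mevalZ md.
Qed.

End LastVariable.

(** * Absolutely summable sequences *)

Section Modulus.
Variable R : realType.
Implicit Types x y : R[i].

(** The norm of [R[i]] has values in [R[i]]; this modulus takes its values in [R], where the order
    is total. *)
Definition nc x : R := Normc.normc x.

Lemma ncE x : `|x| = (nc x)%:C%C. Proof. by case: x. Qed.

Lemma nc_ge0 x : 0 <= nc x. Proof. by case: x => a b; exact: sqrtr_ge0. Qed.

Lemma ncM x y : nc (x * y) = nc x * nc y. Proof. exact: Normc.normcM. Qed.

Lemma ncV x : nc x^-1 = (nc x)^-1. Proof. exact: Normc.normcV. Qed.

Lemma nc0 : nc 0 = 0. Proof. exact: Normc.normc0. Qed.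

Lemma nc1 : nc 1 = 1. Proof. exact: Normc.normc1. Qed.

Lemma ncN x : nc (- x) = nc x. Proof. exact: normcN. Qed.

Lemma ncD x y : nc (x + y) <= nc x + nc y. Proof. exact: le_normcD. Qed.

Lemma nc_eq0 x : (nc x == 0) = (x == 0).
Proof.
by apply/eqP/eqP => [|->]; [exact: Normc.eq0_normc | exact: nc0].
Qed.

Lemma nc_gt0 x : (0 < nc x) = (x != 0).
Proof. by rewrite lt_def nc_eq0 nc_ge0 andbT. Qed.

Lemma ncX x k : nc (x ^+ k) = nc x ^+ k.
Proof. by elim: k => [|k IH]; rewrite ?expr0 ?nc1// !exprS ncM IH. Qed.

Lemma nc_sum (I : Type) (s : seq I) (P : pred I) (F : I -> R[i]) :
  nc (\sum_(i <- s | P i) F i) <= \sum_(i <- s | P i) nc (F i).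
Proof.
elim/big_rec2: _ => [|i a b _ le_ba]; first by rewrite nc0.
by apply: le_trans (ncD _ _) _; rewrite lerD2l.
Qed.

Lemma nc_exp_inj x m k : 0 < nc x -> nc x < 1 -> x ^+ m = x ^+ k -> m = k.
Proof.
move=> x0 x1 /(congr1 nc); rewrite !ncX; apply: ieexprIn => //.
by rewrite lt_eqF.
Qed.

End Modulus.

Section Sums.
Variable R : realType.
Local Notation C := R[i].
Implicit Types (u v : nat -> C) (rho : R).

Lemma geometric_bound (r : R) n : 0 <= r -> r < 1 ->
  \sum_(k < n) r ^+ k <= (1 - r)^-1.
Proof.
move=> r0 r1; rewrite -[leRHS]mul1r ler_pdivlMr ?subr_gt0//.
have -> : (\sum_(k < n) r ^+ k) * (1 - r) = 1 - r ^+ n.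
  rewrite -opprB mulrN mulrC -subrX1 opprB; by [].
by rewrite gerBl exprn_ge0.
Qed.

(** Stands in for the convergence of r^k to 0. *)
Lemma expr_archi (r e B : R) : 0 <= r -> r < 1 -> 0 <= e ->
  (forall k, e <= B * r ^+ k) -> e = 0.
Proof.
move=> r0 r1 e0 eB; apply/eqP; rewrite eq_le e0 andbT.
rewrite leNgt; apply/negP => egt.
(* Summing the bounds, n e is bounded. *)
have sumB n : n%:R * e <= B * (1 - r)^-1.
  have B0 : 0 <= B by have := eB 0%N; rewrite expr0 mulr1; apply: le_trans.
  apply: le_trans (_ : \sum_(k < n) B * r ^+ k <= _).
    rewrite mulr_natl -[n in leLHS]card_ord -sumr_const.
    by apply: ler_sum => k _.
  by rewrite -mulr_sumr ler_wpM2l// geometric_bound.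
set T := B * (1 - r)^-1 in sumB.
have := sumB (Num.bound (T / e)).
rewrite -ler_pdivlMr// leNgt => /negP; apply.
apply: le_lt_trans (archi_boundP _); first exact: lexx.
rewrite divr_ge0// ?(ltW egt)//; have := sumB 0%N; by rewrite mul0r.
Qed.

(** Absolute convergence on the disc of radius [rho], as a bound on partial sums, so that no limit
    has to be formed. *)
Definition abs_summable rho u :=
  exists B, forall n, \sum_(k < n) nc (u k) * rho ^+ k <= B.

Lemma abs_summable_bound rho u : 0 <= rho -> abs_summable rho u ->
  exists2 B, 0 <= B & forall k, nc (u k) * rho ^+ k <= B.
Proof.
move=> rho0 [B uB]; exists B; first by have := uB 0%N; rewrite big_ord0.
move=> k; apply: le_trans (uB k.+1); rewrite big_ord_recr /= lerDr.
by apply: sumr_ge0 => i _; rewrite mulr_ge0 ?nc_ge0 ?exprn_ge0.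
Qed.

Lemma abs_summable_le rho rho' u : 0 <= rho' -> rho' <= rho ->
  abs_summable rho u -> abs_summable rho' u.
Proof.
move=> rho0 le_rho [B uB]; exists B => n; apply: le_trans (uB n).
apply: ler_sum => k _; rewrite ler_wpM2l ?nc_ge0//.
by rewrite lerXn2r ?nnegrE// (le_trans rho0).
Qed.

Lemma abs_summable_geometric rho u (B r : R) : 0 <= rho -> 0 <= r ->
  r * rho < 1 -> (forall k, nc (u k) <= B * r ^+ k) -> abs_summable rho u.
Proof.
move=> rho0 r0 lt1 uB; have rr0 : 0 <= r * rho by rewrite mulr_ge0.
have B0 : 0 <= B.
  by have := uB 0%N; rewrite expr0 mulr1; apply: le_trans; exact: nc_ge0.
exists (B * (1 - r * rho)^-1) => n.
apply: le_trans (_ : \sum_(k < n) B * (r * rho) ^+ k <= _).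
  apply: ler_sum => k _; rewrite exprMn mulrA ler_wpM2r ?exprn_ge0//.
by rewrite -mulr_sumr ler_wpM2l// geometric_bound.
Qed.

Lemma abs_summable_poly rho (P : {poly C}) : 0 <= rho ->
  abs_summable rho (fun k => P`_k).
Proof.
move=> rho0; exists (\sum_(k < size P) nc P`_k * rho ^+ k) => n.
pose F k := nc P`_k * rho ^+ k.
have F0 k : 0 <= F k by rewrite mulr_ge0 ?nc_ge0 ?exprn_ge0.
have [le_n|lt_n] := leqP n (size P).
  rewrite -(subnKC le_n) big_split_ord /= lerDl.
  by apply: sumr_ge0 => i _; exact: F0.
rewrite -(subnKC (ltnW lt_n)) big_split_ord /= gerDl big1// => i _.
by rewrite nth_default ?leq_addr// nc0 mul0r.
Qed.

Lemma abs_summableD rho u v : 0 <= rho ->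
  abs_summable rho u -> abs_summable rho v -> abs_summable rho (u + v).
Proof.
move=> rho0 [B uB] [B' vB]; exists (B + B') => n.
apply: le_trans (lerD (uB n) (vB n)); rewrite -big_split /=.
by apply: ler_sum => k _; rewrite -mulrDl ler_wpM2r ?exprn_ge0// ncD.
Qed.

(** The product of the two truncated polynomials, evaluated at 1, contains all terms of the left
    side and further nonnegative ones. *)
Lemma sum_conv_le (a b : nat -> R) n :
  (forall k, 0 <= a k) -> (forall k, 0 <= b k) ->
  \sum_(k < n) Defs.conv a b k <= (\sum_(k < n) a k) * (\sum_(k < n) b k).
Proof.
move=> a0 b0; set p := \poly_(i < n) a i; set s := \poly_(i < n) b i.
have hE (c : nat -> R) : (\poly_(i < n) c i).[1] = \sum_(k < n) c k.
  rewrite (@horner_coef_wide _ n) ?size_poly//; apply: eq_bigr => k _.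
  by rewrite expr1n mulr1 coef_poly ltn_ord.
rewrite -(hE a) -(hE b) -hornerM.
rewrite (@horner_coef_wide _ (n + n)); last first.
  apply: leq_trans (size_polyMleq _ _) _.
  by apply: leq_trans (leq_pred _) _; rewrite leq_add ?size_poly.
rewrite big_split_ord /= -[leLHS]addr0 lerD//.
  by apply: ler_sum => k _; rewrite expr1n mulr1 -conv_poly.
apply: sumr_ge0 => k _; rewrite expr1n mulr1 coefM.
apply: sumr_ge0 => i _; rewrite !coef_poly.
by do 2 case: ifP => _; rewrite ?mulr0 ?mul0r ?mulr_ge0.
Qed.

Lemma abs_summableM rho u v : 0 <= rho ->
  abs_summable rho u -> abs_summable rho v ->
  abs_summable rho (Defs.conv u v).
Proof.
move=> rho0 [B uB] [B' vB]; exists (B * B') => n.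
pose a (w : nat -> C) k := nc (w k) * rho ^+ k.
have a0 w k : 0 <= a w k by rewrite mulr_ge0 ?nc_ge0 ?exprn_ge0.
apply: le_trans (_ : (\sum_(k < n) a u k) * (\sum_(k < n) a v k) <= _).
  apply: le_trans (sum_conv_le _ (a0 u) (a0 v)).
  apply: ler_sum => k _; rewrite /Defs.conv.
  apply: le_trans (ler_wpM2r (exprn_ge0 _ rho0) (nc_sum _ _ _)) _.
  rewrite mulr_suml; apply: ler_sum => i _; rewrite ncM /a mulrACA -exprD.
  by rewrite subnKC// -ltnS.
by rewrite ler_pM// ?sumr_ge0// => k _; exact: a0.
Qed.

(** By the recursion for v, |u_0| times a partial sum of v is at most 1 plus the tail of u times the
    previous partial sum. Once the tail is at most |u_0| / 2, the bound 2 / |u_0| reproduces itself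
    by induction. *)
Lemma abs_summable_conv_inv u rho : 0 < rho -> u 0%N != 0 ->
    abs_summable rho u ->
  exists2 r, 0 < r <= rho & forall v, Defs.conv u v = @Defs.conv1 C ->
    abs_summable r v.
Proof.
move=> rho0 u0 [T uT]; have T0 : 0 <= T by have := uT 0%N; rewrite big_ord0.
have nu0 : 0 < nc (u 0%N) by rewrite nc_gt0.
pose r := rho * (nc (u 0%N) / (2 * (T + nc (u 0%N)))).
have D0 : 0 < 2 * (T + nc (u 0%N)) by rewrite mulr_gt0// ltr_wpDl.
have r0 : 0 < r by rewrite mulr_gt0// divr_gt0.
have rle : r <= rho.
  rewrite /r ger_pMr// ler_pdivrMr// mul1r; lra.
exists r; first by rewrite r0.
(* The tail of u has at most half the size of u 0 on the disc of radius r. *)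
have tail n : \sum_(k < n) nc (u k.+1) * r ^+ k.+1 <= nc (u 0%N) / 2.
  apply: le_trans (_ : (r / rho) * (\sum_(k < n) nc (u k.+1) * rho ^+ k.+1) <= _).
    rewrite mulr_sumr; apply: ler_sum => k _; rewrite mulrCA ler_wpM2l ?nc_ge0//.
    have -> : r ^+ k.+1 = (r / rho) ^+ k.+1 * rho ^+ k.+1.
      by rewrite -exprMn divfK ?gt_eqF.
    rewrite ler_wpM2r ?exprn_ge0 ?(ltW rho0)//.
    have q1 : r / rho <= 1 by rewrite ler_pdivrMr// mul1r.
    by rewrite exprS ger_pMr ?divr_gt0// exprn_ile1// divr_ge0// ltW.
  apply: le_trans (_ : (r / rho) * T <= _).
    rewrite ler_wpM2l ?divr_ge0 ?(ltW r0) ?(ltW rho0)//.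
    apply: le_trans (uT n.+1).
    by rewrite big_ord_recl /= lerDr mulr_ge0 ?nc_ge0// exprn_ge0 ?ltW.
  have -> : r / rho = nc (u 0%N) / (2 * (T + nc (u 0%N))).
    by rewrite /r [rho * _]mulrC mulfK ?gt_eqF.
  rewrite mulrAC ler_pdivrMr//.
  set a := nc _ in nu0 *; nra.
move=> v uv; exists (2 / nc (u 0%N)).
have vE k : u 0%N * v k = (k == 0%N)%:R - \sum_(i < k) u i.+1 * v (k - i.+1)%N.
  have /(congr1 (@^~ k)) := uv; rewrite /Defs.conv /Defs.conv1 big_ord_recl subn0.
  by move=> <-; rewrite /bump /= addrK.
pose a k := nc (u k.+1) * r ^+ k.+1; pose b k := nc (v k) * r ^+ k.
have a0 k : 0 <= a k by rewrite mulr_ge0 ?nc_ge0// exprn_ge0// ltW.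
have b0 k : 0 <= b k by rewrite mulr_ge0 ?nc_ge0// exprn_ge0// ltW.
elim=> [|n IH]; first by rewrite big_ord0 divr_ge0 ?nc_ge0.
rewrite ler_pdivlMr// mulrC mulr_sumr.
apply: le_trans (_ : 1 + (\sum_(k < n) a k) * (\sum_(k < n) b k) <= _); last first.
  apply: le_trans (_ : 1 + (nc (u 0%N) / 2) * (2 / nc (u 0%N)) <= _).
    by rewrite lerD2l ler_pM ?sumr_ge0.
  by rewrite mulrA divfK// divff ?gt_eqF//; lra.
rewrite big_ord_recl /= expr0 mulr1 -ncM vE big_ord0 subr0 nc1 lerD2l.
apply: le_trans (sum_conv_le n a0 b0); apply: ler_sum => k _.
rewrite /bump /= !add1n mulrA -ncM vE /= sub0r ncN.
apply: le_trans (ler_wpM2r (exprn_ge0 _ (ltW r0)) (nc_sum _ _ _)) _.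
rewrite mulr_suml /Defs.conv; apply: ler_sum => i _; rewrite ncM /a /b mulrACA -exprD.
by rewrite subSS addSn subnKC// -ltnS.
Qed.

(* Completeness of R enters through a supremum of lower bounds. *)
Lemma series_value rho u x T : nc x < rho ->
    (forall n, \sum_(k < n) nc (u k) * rho ^+ k <= T) ->
  exists v : C, forall M,
    nc (v - \sum_(k < M) u k * x ^+ k) <= 2 * T * (nc x / rho) ^+ M.
Proof.
move=> xrho uT; have rho0 : 0 < rho by apply: le_lt_trans xrho; exact: nc_ge0.
have T0 : 0 <= T by have := uT 0%N; rewrite big_ord0.
pose S n := \sum_(k < n) u k * x ^+ k; pose E n := T * (nc x / rho) ^+ n.
have xr0 : 0 <= nc x / rho by rewrite divr_ge0 ?nc_ge0 ?ltW.
have xr1 : nc x / rho <= 1 by rewrite ler_pdivrMr// mul1r ltW.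
have SE m d : nc (S (m + d)%N - S m) <= E m.
  rewrite /S big_split_ord /= addrAC subrr add0r.
  apply: le_trans (nc_sum _ _ _) _.
  apply: le_trans (_ : (nc x / rho) ^+ m *
     (\sum_(i < d) nc (u (m + i)%N) * rho ^+ (m + i)) <= _).
    rewrite mulr_sumr; apply: ler_sum => i _; rewrite ncM ncX mulrCA.
    rewrite ler_wpM2l ?nc_ge0//.
    have -> : nc x ^+ (m + i) = (nc x / rho) ^+ (m + i) * rho ^+ (m + i).
      by rewrite -exprMn divfK ?gt_eqF.
    rewrite ler_wpM2r ?exprn_ge0 ?(ltW rho0)// exprD.
    by rewrite ler_piMr ?exprn_ile1// exprn_ge0.
  rewrite /E mulrC ler_wpM2r ?exprn_ge0//; apply: le_trans (uT (m + d)%N).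
  rewrite big_split_ord /= lerDr; apply: sumr_ge0 => i _.
  by rewrite mulr_ge0 ?nc_ge0// exprn_ge0 ?ltW.
have E0 n : 0 <= E n by rewrite mulr_ge0// exprn_ge0.
have realP (s : nat -> R) : (forall m d, `|s (m + d)%N - s m| <= E m) ->
    exists l, forall m, `|l - s m| <= E m.
  move=> sE; pose A := [set s m - E m | m in [set: nat]].
  have ub k : ubound A (s k + E k).
    move=> _ [m _ <-]; have [mk|km] := leqP m k.
      have := sE m (k - m)%N; rewrite subnKC// ler_norml => /andP[].
      have := E0 k; lra.
    have := sE k (m - k)%N; rewrite subnKC ?(ltnW km)// ler_norml => /andP[].
    have := E0 m; lra.
  have hA : has_sup A by split; [exists (s 0%N - E 0%N), 0%N | exists (s 0%N + E 0%N); exact: ub].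
  exists (sup A) => m; rewrite ler_norml; apply/andP; split.
    have /(_ (s m - E m)) : ubound A (sup A) by exact: sup_upper_bound.
    by move=> /(_ (ex_intro2 _ _ m Logic.I erefl)); lra.
  have : sup A <= s m + E m by apply: ge_sup => //; exact: hA.1.
  lra.
have reP (z : C) : `|complex.Re z| <= nc z.
  case: z => a b /=; rewrite -sqrtr_sqr /nc /= ler_wsqrtr//.
  by rewrite lerDl sqr_ge0.
have imP (z : C) : `|complex.Im z| <= nc z.
  case: z => a b /=; rewrite -sqrtr_sqr /nc /= ler_wsqrtr//.
  by rewrite lerDr sqr_ge0.
have reB (y z : C) : complex.Re (y - z) = complex.Re y - complex.Re z.
  by case: y z => [? ?] [].
have imB (y z : C) : complex.Im (y - z) = complex.Im y - complex.Im z.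
  by case: y z => [? ?] [].
have [|a aP] := realP (fun n => complex.Re (S n)).
  by move=> m d; rewrite -reB; apply: le_trans (reP _) (SE m d).
have [|b bP] := realP (fun n => complex.Im (S n)).
  by move=> m d; rewrite -imB; apply: le_trans (imP _) (SE m d).
exists (a +i* b)%C => M; rewrite -/(S M) -mulrA -/(E M).
(* Real and imaginary parts have been approximated separately; hence the factor 2 in the
   estimate. *)
have ncRI (z : C) : nc z <= `|complex.Re z| + `|complex.Im z|.
  case: z => c d /=; rewrite -[leRHS]ger0_norm ?addr_ge0// -sqrtr_sqr.
  rewrite /nc /= ler_wsqrtr// -(real_normK (num_real c)) -(real_normK (num_real d)).
  by have := normr_ge0 c; have := normr_ge0 d; nra.
apply: le_trans (ncRI _) _; rewrite reB imB /= mulr2n mulrDl mul1r.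
by rewrite lerD ?aP ?bP.
Qed.

End Sums.

(** * Meromorphic series regular or vanishing at a point *)

Section Local.
Variables (R : realType) (j : nat).
Local Notation C := R[i].
Local Notation L := (puiseux C).
Local Notation pt := (@pt C j).
Implicit Types (x : C) (rho : R) (w : L) (P Q : {poly C}).

Definition on_disc rho w := exists2 u, w = ser j u & abs_summable rho u.

(** This is a condition on the whole closed disc of radius |x|, not only near [x]. *)
Definition holo x w := exists2 rho, nc x < rho & on_disc rho w.

(* w is meromorphic in t near the disc of radius |x|, and regular at x. *)
Definition regular x w := exists2 Q, Q.[x] != 0 & holo x (pt Q * w).

Definition vanish x w := exists2 w', regular x w' & w = pt ('X - x%:P) * w'.

Lemma on_disc_le rho rho' w : 0 <= rho' -> rho' <= rho ->
  on_disc rho w -> on_disc rho' w.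
Proof. by move=> r0 le_r [u -> su]; exists u => //; apply: abs_summable_le su. Qed.

Lemma on_discD rho w w' : 0 <= rho ->
  on_disc rho w -> on_disc rho w' -> on_disc rho (w + w').
Proof.
move=> rho0 [u -> su] [v -> sv]; exists (u + v); first by rewrite serD.
exact: abs_summableD.
Qed.

Lemma on_discM rho w w' : 0 <= rho ->
  on_disc rho w -> on_disc rho w' -> on_disc rho (w * w').
Proof.
move=> rho0 [u -> su] [v -> sv]; exists (Defs.conv u v); first by rewrite serM.
exact: abs_summableM.
Qed.

Lemma on_disc_pt rho P : 0 <= rho -> on_disc rho (pt P).
Proof. by move=> rho0; exists (fun k => P`_k) => //; apply: abs_summable_poly. Qed.

Lemma holo_pt x P : holo x (pt P).
Proof.
exists (nc x + 1); first by rewrite ltrDl ltr01.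
by apply: on_disc_pt; rewrite addr_ge0 ?nc_ge0.
Qed.

Lemma holo_common x w w' : holo x w -> holo x w' ->
  exists rho, [/\ nc x < rho, 0 <= rho, on_disc rho w & on_disc rho w'].
Proof.
move=> [r xr sr] [r' xr' sr']; exists (Num.min r r').
have m0 : 0 <= Num.min r r'.
  by rewrite le_min !(le_trans (nc_ge0 x))// ltW.
split=> //; first by rewrite lt_min xr.
  by apply: on_disc_le sr; rewrite // ge_min lexx.
by apply: on_disc_le sr'; rewrite // ge_min lexx orbT.
Qed.

Lemma holoD x w w' : holo x w -> holo x w' -> holo x (w + w').
Proof.
move=> hw hw'; have [r [xr r0 sr sr']] := holo_common hw hw'.
by exists r => //; apply: on_discD.
Qed.

Lemma holoM x w w' : holo x w -> holo x w' -> holo x (w * w').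
Proof.
move=> hw hw'; have [r [xr r0 sr sr']] := holo_common hw hw'.
by exists r => //; apply: on_discM.
Qed.

Lemma holo_regular x w : holo x w -> regular x w.
Proof. by move=> hw; exists 1; rewrite ?hornerC ?oner_eq0// rmorph1 mul1r. Qed.

Lemma regular_pt x P : regular x (pt P).
Proof. exact/holo_regular/holo_pt. Qed.

Lemma regular0 x : regular x 0.
Proof. by rewrite -(rmorph0 pt); exact: regular_pt. Qed.

Lemma regular1 x : regular x 1.
Proof. by rewrite -(rmorph1 pt); exact: regular_pt. Qed.

Lemma regularD x w w' : regular x w -> regular x w' -> regular x (w + w').
Proof.
move=> [P Px hw] [Q Qx hw']; exists (P * Q); first by rewrite hornerM mulf_neq0.
have -> : pt (P * Q) * (w + w') = pt Q * (pt P * w) + pt P * (pt Q * w').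
  by rewrite rmorphM /=; ring.
by apply: holoD; apply: holoM => //; exact: holo_pt.
Qed.

Lemma regularM x w w' : regular x w -> regular x w' -> regular x (w * w').
Proof.
move=> [P Px hw] [Q Qx hw']; exists (P * Q); first by rewrite hornerM mulf_neq0.
by rewrite rmorphM /= mulrACA; exact: holoM.
Qed.

Lemma regularX x w k : regular x w -> regular x (w ^+ k).
Proof.
move=> hw; elim: k => [|k IH]; first exact: regular1.
by rewrite exprS; exact: regularM.
Qed.

Lemma regular_sum x (I : Type) (s : seq I) (Pr : pred I) (F : I -> L) :
  (forall i, Pr i -> regular x (F i)) -> regular x (\sum_(i <- s | Pr i) F i).
Proof.
by move=> hF; elim/big_ind: _ => //; [exact: regular0 | exact: regularD].
Qed.

Lemma regular_cancel x Q w : Q.[x] != 0 -> regular x (pt Q * w) -> regular x w.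
Proof.
move=> Qx [P Px hw]; exists (P * Q); first by rewrite hornerM mulf_neq0.
by rewrite rmorphM /= -mulrA.
Qed.

Lemma pt_neq0 x Q : Q.[x] != 0 -> pt Q != 0.
Proof. by rewrite pt_eq0; apply: contra_neq => ->; rewrite horner0. Qed.

Lemma regularV x Q : Q.[x] != 0 -> regular x (pt Q)^-1.
Proof.
move=> Qx; apply: (regular_cancel Qx).
by rewrite divff ?(pt_neq0 Qx)//; exact: regular1.
Qed.

Lemma vanish_regular x w : vanish x w -> regular x w.
Proof. by move=> [w' hw' ->]; apply: regularM => //; exact: regular_pt. Qed.

Lemma vanish0 x : vanish x 0.
Proof. by exists 0; [exact: regular0 | rewrite mulr0]. Qed.

Lemma vanishD x w w' : vanish x w -> vanish x w' -> vanish x (w + w').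
Proof.
move=> [v hv ->] [v' hv' ->]; exists (v + v'); first exact: regularD.
by rewrite mulrDr.
Qed.

Lemma vanishMl x w w' : regular x w -> vanish x w' -> vanish x (w * w').
Proof.
move=> hw [v hv ->]; exists (w * v); first exact: regularM.
by rewrite mulrCA.
Qed.

Lemma vanishMr x w w' : vanish x w -> regular x w' -> vanish x (w * w').
Proof. by move=> hw hw'; rewrite mulrC; exact: vanishMl. Qed.

Lemma vanishN x w : vanish x w -> vanish x (- w).
Proof.
move=> hw; rewrite -mulN1r; apply: vanishMl => //.
by rewrite -(rmorph1 pt) -rmorphN; exact: regular_pt.
Qed.

Lemma vanishB x w w' : vanish x w -> vanish x w' -> vanish x (w - w').
Proof. by move=> hw hw'; apply: vanishD => //; exact: vanishN. Qed.

Lemma vanish_sum x (I : Type) (s : seq I) (Pr : pred I) (F : I -> L) :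
  (forall i, Pr i -> vanish x (F i)) -> vanish x (\sum_(i <- s | Pr i) F i).
Proof.
by move=> hF; elim/big_ind: _ => //; [exact: vanish0 | exact: vanishD].
Qed.

Lemma vanish_pt x P : P.[x] = 0 -> vanish x (pt P).
Proof.
move=> /eqP/factor_theorem[Q ->]; exists (pt Q); first exact: regular_pt.
by rewrite -rmorphM /= mulrC.
Qed.

Lemma vanish_cancel x Q w : Q.[x] != 0 -> vanish x (pt Q * w) -> vanish x w.
Proof.
move=> Qx [v hv e]; exists ((pt Q)^-1 * v).
  by apply: regularM => //; exact: regularV.
by rewrite mulrCA -e mulKf ?(pt_neq0 Qx).
Qed.

(* 1 / (t - x) does not converge at x. *)
Lemma vanish_const x (c : C) : vanish x (pt c%:P) -> c = 0.
Proof.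
move=> [w [Q Qx [rho xrho [u wu su]]] cw].
(* Modulo t - x, [Q * c%:P] is its value e = Q(x) c; so e is t - x times the convergent series
   [pt Q * w - pt Q1]. *)
have /factor_theorem[Q1 Q1E] : root (Q * c%:P - (Q.[x] * c)%:P) x.
  by rewrite /root !hornerE subrr.
have rho0 : 0 <= rho by rewrite ltW// (le_lt_trans _ xrho)// nc_ge0.
have [v vE sv] : on_disc rho (pt Q * w - pt Q1).
  rewrite -rmorphN; apply: on_discD => //; first by exists u.
  by rewrite rmorphN -rmorphN; exact: on_disc_pt.
have : pt (Q.[x] * c)%:P = pt ('X - x%:P) * ser j v.
  rewrite -vE mulrBr mulrCA -cw -!rmorphM /= -rmorphB [_ * Q1]mulrC -Q1E.
  by rewrite opprB addrC subrK.
set e := Q.[x] * c; rewrite rmorphB mulrBl -['X]expr1 pt_Xn_ser pt_C_ser.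
rewrite -serN -serD => /ser_inj e_v.
suff e0 : e = 0 by move/eqP: e0; rewrite /e mulf_eq0 (negPf Qx) => /eqP.
have vE0 : e = - (x * v 0%N).
  by have := congr1 (@^~ 0%N) e_v; rewrite coefC /= => ->; exact: add0r.
have vES k : v k = x * v k.+1.
  have := congr1 (@^~ k.+1) e_v; rewrite coefC /=.
  by rewrite -[RHS]/(v (k.+1 - 1)%N - x * v k.+1) subn1 => /eqP; rewrite eq_sym subr_eq0 => /eqP.
(* |v_k| |x|^(k+1) does not depend on k, whereas convergence on a radius rho > |x| makes it decay
   geometrically. *)
have vk k : nc e = nc x * (nc (v k) * nc x ^+ k).
  elim: k => [|k ->]; first by rewrite mulr1 vE0 ncN ncM.
  by rewrite (vES k) ncM exprS; ring.
have [x0|x0] := eqVneq (nc x) 0.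
  by apply/eqP; rewrite -nc_eq0 (vk 0%N) x0 mul0r.
have [B B0 vB] := abs_summable_bound rho0 sv.
have rgt : 0 < rho by apply: le_lt_trans xrho; exact: nc_ge0.
apply/eqP; rewrite -nc_eq0; apply/eqP.
apply: (@expr_archi _ (nc x / rho) (nc e) (nc x * B)).
- by rewrite divr_ge0 ?nc_ge0.
- by rewrite ltr_pdivrMr// mul1r.
- exact: nc_ge0.
move=> k; rewrite (vk k) -mulrA ler_wpM2l ?nc_ge0//.
have -> : nc x ^+ k = rho ^+ k * (nc x / rho) ^+ k.
  by rewrite -exprMn mulrC divfK ?gt_eqF.
by rewrite mulrA ler_wpM2r// exprn_ge0// divr_ge0 ?nc_ge0.
Qed.

Lemma ser_neq0_factor u : ser j u != 0 -> exists d (v : nat -> C),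
  [/\ v 0%N != 0, ser j u = pt 'X^d * ser j v & forall k, v k = u (k + d)%N].
Proof.
move=> u0; have exu : exists k, u k != 0.
  apply: contrapT => /forallNP un; case/eqP: u0; rewrite -(ser0 _ j); congr ser.
  by apply/funext => k; exact/eqP/negPn/negP/un.
have [d ud dmin] := ex_minnP exu; exists d, (fun k => u (k + d)%N); split=> //.
rewrite pt_Xn_ser; congr ser; apply/funext => k.
case: ltnP => [kd|dk]; last by rewrite subnK.
by apply/eqP; apply: contraTT kd => /dmin; rewrite leqNgt.
Qed.

Lemma on_disc_inv rho (v : nat -> C) : 0 < rho -> v 0%N != 0 ->
  abs_summable rho v -> exists2 r, 0 < r & on_disc r (ser j v)^-1.
Proof.
move=> rho0 v0 sv; have [r /andP[r0 _] rP] := abs_summable_conv_inv rho0 v0 sv.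
have [v' vv'] := conv_inv_ex v0; exists r => //; exists v'; last exact: rP.
have := congr1 (ser j) vv'; rewrite serM ser1 => e.
have vn0 : ser j v != 0.
  by apply: contra_eq_neq e => ->; rewrite mul0r eq_sym oner_neq0.
by apply: (mulfI vn0); rewrite e divff.
Qed.

(** Write w = t^d v with v(0) nonzero. The inverse of v converges near 0, so a zero x of w in that
    disc, x nonzero, would make the constant 1 vanish at x. *)
Lemma vanish_near0 rho w : 0 < rho -> on_disc rho w -> w != 0 ->
  exists2 r, 0 < r & forall x, x != 0 -> nc x < r -> ~ vanish x w.
Proof.
move=> rho0 [u -> su] u0; have [d [v [v0 uv vE]]] := ser_neq0_factor u0.
have sv : abs_summable rho v.
  have [B uB] := su; exists (B / rho ^+ d) => n.
  rewrite ler_pdivlMr ?exprn_gt0// mulr_suml; apply: le_trans (uB (d + n)%N).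
  rewrite big_split_ord /= -[leLHS]add0r lerD//.
    by apply: sumr_ge0 => k _; rewrite mulr_ge0 ?nc_ge0// exprn_ge0 ?ltW.
  by apply: ler_sum => k _; rewrite vE -mulrA -exprD addnC.
have [r r0 rP] := on_disc_inv rho0 v0 sv; exists r => // x x0 xr.
rewrite uv => /vanish_cancel; rewrite hornerXn => /(_ (expf_neq0 _ x0)).
have vn0 : ser j v != 0.
  by apply: contraNneq u0 => v00; rewrite uv v00 mulr0.
move=> /vanishMr/(_ (holo_regular (ex_intro2 _ _ r xr rP))).
rewrite divff// -(rmorph1 pt) -polyC1 => /vanish_const/eqP.
by rewrite oner_eq0.
Qed.

(** Division by t - x with the value as remainder, the quotient still converging beyond |x|. The
    estimate on partial sums is kept for the Mittag-Leffler decomposition. *)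
Lemma value_ex rho (u : nat -> C) x T : x != 0 -> nc x < rho ->
    (forall n, \sum_(k < n) nc (u k) * rho ^+ k <= T) ->
  exists (v : C) w, [/\ holo x w,
    ser j u = pt v%:P + pt ('X - x%:P) * w &
    forall M, nc (v - \sum_(k < M) u k * x ^+ k) <= 2 * T * (nc x / rho) ^+ M].
Proof.
move=> x0 xrho su; have [v vB] := series_value xrho su.
have nx0 : 0 < nc x by rewrite nc_gt0.
have rho0 : 0 < rho by apply: lt_trans xrho.
(* The tail sum of u_i x^(i-k-1) over i > k, expressed through [v]; its modulus is at most 2 T /
   rho^(k+1). *)
pose w k := (v - \sum_(i < k.+1) u i * x ^+ i) * x ^- k.+1.
exists v, (ser j w); split=> //.
  exists ((nc x + rho) / 2); first by lra.
  exists w => //; apply: (@abs_summable_geometric _ _ _ (2 * T / rho) rho^-1).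
  - by lra.
  - by rewrite invr_ge0 ltW.
  - by rewrite mulrC ltr_pdivrMr// mul1r; lra.
  move=> k; rewrite /w ncM ncV ncX.
  rewrite ler_pdivrMr ?exprn_gt0//; apply: le_trans (vB k.+1) _.
  rewrite exprMn exprVn [rho ^+ _]exprS invfM exprVn.
  by rewrite le_eqVlt; apply/orP; left; apply/eqP; ring.
rewrite rmorphB mulrBl -['X]expr1 pt_Xn_ser pt_C_ser -serN -!serD.
congr ser; apply/funext => k.
rewrite -[RHS]/((v%:P : {poly C})`_k + ((if (k < 1)%N then 0 else w (k - 1)%N) - x * w k)).
rewrite coefC /w; case: k => [|k] /=.
  by rewrite big_ord_recl big_ord0 /= expr0 expr1; field.
rewrite subn1 /= !big_ord_recr /= !exprS.
set S := \sum_(i < _) _; set y := x ^+ k; have y0 : y != 0 by rewrite expf_neq0.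
by field; rewrite x0 y0.
Qed.

End Local.

(** * Dilations of the variable *)

Section Scaling.
Variables (R : realType) (j : nat).
Local Notation C := R[i].
Local Notation L := (puiseux C).
Local Notation pt := (@pt C j).
Implicit Types (x : C) (w : L) (P Q : {poly C}).

Lemma sigma_ser q0 qs (u : nat -> C) : compatible_roots q0 qs ->
  sigma qs (ser j u) = ser j (fun k => qs j.+1 ^+ k * u k).
Proof.
move=> qsP; apply/pcoef_inj.
rewrite [LHS](sigma_laurent qsP 0 u (ltn0Sn j)).
by congr laurent_fun; apply/funext => k; rewrite add0r.
Qed.

Lemma coef_comp_scaleX P (c : C) k : (P \Po (c *: 'X))`_k = c ^+ k * P`_k.
Proof.
rewrite comp_polyE coef_sum.
have [kP|Pk] := ltnP k (size P).
  rewrite (bigD1 (Ordinal kP))//= exprZn !coefZ coefXn eqxx mulr1 mulrC.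
  rewrite big1 ?addr0// => i ik; rewrite exprZn !coefZ coefXn.
  by rewrite -val_eqE /= eq_sym in ik; rewrite (negPf ik) !mulr0.
rewrite (nth_default 0 Pk) mulr0 big1// => i _; rewrite exprZn !coefZ coefXn.
by rewrite gtn_eqF ?mulr0// (leq_trans (ltn_ord i)).
Qed.

Lemma sigma_pt q0 qs P : compatible_roots q0 qs ->
  sigma qs (pt P) = pt (P \Po (qs j.+1 *: 'X)).
Proof.
move=> qsP; rewrite /pt (sigma_ser _ qsP); congr ser.
by apply/funext => k; rewrite coef_comp_scaleX.
Qed.

Lemma on_disc_sigma q0 qs rho w : compatible_roots q0 qs ->
  on_disc j (nc (qs j.+1) * rho) w -> on_disc j rho (sigma qs w).
Proof.
move=> qsP [u -> [B uB]]; rewrite (sigma_ser _ qsP); eexists; first by [].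
exists B => n; apply: le_trans (uB n); apply: ler_sum => k _.
by rewrite ncM ncX exprMn mulrCA mulrA.
Qed.

(** With p = [qs j.+1], [sigma qs] turns w(t) into w(p t), so its behaviour at x is that of w at p
    x. *)
Lemma holo_sigma q0 qs x w : q0 != 0 -> compatible_roots q0 qs ->
  holo j (qs j.+1 * x) w -> holo j x (sigma qs w).
Proof.
move=> q00 qsP [rho xrho hw]; have p0 := qs_neq0 q00 qsP (ltn0Sn j).
have np0 : 0 < nc (qs j.+1) by rewrite nc_gt0.
exists (rho / nc (qs j.+1)); first by rewrite ltr_pdivlMr// mulrC -ncM.
apply: (on_disc_sigma qsP).
by rewrite mulrC divfK ?gt_eqF.
Qed.

Lemma regular_sigma q0 qs x w : q0 != 0 -> compatible_roots q0 qs ->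
  regular j (qs j.+1 * x) w -> regular j x (sigma qs w).
Proof.
move=> q00 qsP [Q Qx hw]; exists (Q \Po (qs j.+1 *: 'X)).
  by rewrite horner_comp !hornerE.
by rewrite -(sigma_pt _ qsP) -(sigmaM q00 qsP); exact: (holo_sigma q00 qsP).
Qed.

Lemma vanish_sigma q0 qs x w : q0 != 0 -> compatible_roots q0 qs ->
  vanish j (qs j.+1 * x) w -> vanish j x (sigma qs w).
Proof.
move=> q00 qsP [w' hw' ->]; rewrite (sigmaM q00 qsP) (sigma_pt _ qsP).
apply: vanishMr; last exact: (regular_sigma q00 qsP).
by apply: vanish_pt; rewrite horner_comp !hornerE subrr.
Qed.

Lemma compatible_rootsV q0 (qs : nat -> C) : compatible_roots q0 qs ->
  compatible_roots q0^-1 (fun i => (qs i)^-1).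
Proof.
move=> [qs1 qs2]; split=> [i i0|i k l i0 ikl]; rewrite exprVn.
  by rewrite qs1.
by rewrite (qs2 _ _ _ i0 ikl).
Qed.

Lemma sigmaV q0 (qs : nat -> C) : q0 != 0 -> compatible_roots q0 qs ->
  cancel (sigma qs) (sigma (fun i => (qs i)^-1)).
Proof.
move=> q00 qsP w; apply/pcoef_inj/funext => r /=.
have wV : sigma_weight (fun j => (qs j)^-1) r = (sigma_weight qs r)^-1.
  by rewrite /sigma_weight exprz_inv invr_expz.
by rewrite wV mulKf// expfz_neq0// (qs_neq0 q00 qsP)// absz_gt0 denq_eq0.
Qed.

Lemma vanish_sigmaV q0 qs x w : q0 != 0 -> compatible_roots q0 qs ->
  vanish j x (sigma qs w) -> vanish j (qs j.+1 * x) w.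
Proof.
move=> q00 qsP hw; rewrite -[w](sigmaV q00 qsP).
have q0V : q0^-1 != 0 by rewrite invr_eq0.
apply: (vanish_sigma q0V (compatible_rootsV qsP)).
by rewrite mulKf// (qs_neq0 q00 qsP).
Qed.

Lemma regular_sigma_iter q0 qs x w k : q0 != 0 -> compatible_roots q0 qs ->
  regular j (qs j.+1 ^+ k * x) w -> regular j x (iter k (sigma qs) w).
Proof.
move=> q00 qsP; elim: k x => [|k IH] x; first by rewrite mul1r.
by rewrite exprSr -mulrA => /IH /(regular_sigma q00 qsP).
Qed.

Lemma holo_sigma_iter q0 qs x w k : q0 != 0 -> compatible_roots q0 qs ->
  holo j (qs j.+1 ^+ k * x) w -> holo j x (iter k (sigma qs) w).
Proof.
move=> q00 qsP; elim: k x => [|k IH] x; first by rewrite mul1r.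
by rewrite exprSr -mulrA => /IH /(holo_sigma q00 qsP).
Qed.

Lemma vanish_sigma_iter q0 qs x w k : q0 != 0 -> compatible_roots q0 qs ->
  vanish j (qs j.+1 ^+ k * x) w -> vanish j x (iter k (sigma qs) w).
Proof.
move=> q00 qsP; elim: k x => [|k IH] x; first by rewrite mul1r.
by rewrite exprSr -mulrA => /IH /(vanish_sigma q00 qsP).
Qed.

Lemma vanish_sigma_iterV q0 qs x w k : q0 != 0 -> compatible_roots q0 qs ->
  vanish j x (iter k (sigma qs) w) -> vanish j (qs j.+1 ^+ k * x) w.
Proof.
move=> q00 qsP; elim: k x => [|k IH] x; first by rewrite mul1r.
by move=> /(vanish_sigmaV q00 qsP)/IH; rewrite exprSr -mulrA.
Qed.

Lemma sigma0 (qs : nat -> C) : sigma qs 0 = 0.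
Proof. by apply/pcoef_inj/funext => r; exact: mulr0. Qed.

Lemma sigma_sum (qs : nat -> C) (I : Type) (s : seq I) (Pr : pred I)
    (F : I -> L) :
  sigma qs (\sum_(i <- s | Pr i) F i) = \sum_(i <- s | Pr i) sigma qs (F i).
Proof. by rewrite (big_morph _ (sigmaD qs) (sigma0 qs)). Qed.

Lemma sigma_comm (qs qs' : nat -> C) w :
  sigma qs (sigma qs' w) = sigma qs' (sigma qs w).
Proof. by apply/pcoef_inj/funext => r /=; rewrite mulrCA. Qed.

Lemma sigma_iter_comm (qs qs' : nat -> C) w k :
  sigma qs (iter k (sigma qs') w) = iter k (sigma qs') (sigma qs w).
Proof. by elim: k => //= k <-; rewrite sigma_comm. Qed.

Lemma pt_geometric (c : C) : (pt (1 - c *: 'X))^-1 = ser j (fun k => c ^+ k).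
Proof.
have Q0 : pt (1 - c *: 'X) != 0.
  by rewrite (@pt_neq0 _ _ 0)// !hornerE ?mulr0 ?subr0 oner_neq0.
apply: (mulfI Q0); rewrite divff//.
rewrite rmorphB rmorph1 mulrBl mul1r -mul_polyC rmorphM /= -mulrA.
rewrite -['X]expr1 pt_Xn_ser pt_C_ser -serN -serD -(ser1 _ j); congr ser.
apply/funext => k; rewrite /Defs.conv1.
rewrite -[RHS]/(c ^+ k - c * (if (k < 1)%N then 0 else c ^+ (k - 1))).
by case: k => [|k]; rewrite ?mulr0 ?subr0// subn1 /= exprS subrr.
Qed.

Lemma holo_geometric x (c : C) : nc c * nc x < 1 ->
  holo j x (pt (1 - c *: 'X))^-1.
Proof.
move=> cx1; rewrite pt_geometric.
have [r [r0 xr cr]] : exists r, [/\ 0 <= r, nc x < r & nc c * r < 1].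
  have [->|c0] := eqVneq c 0.
    by exists (nc x + 1); rewrite nc0 mul0r ltrDl ltr01 addr_ge0 ?nc_ge0.
  have nc0' : 0 < nc c by rewrite nc_gt0.
  have xc : nc x < (nc c)^-1 by rewrite -[_^-1]mul1r ltr_pdivlMr// mulrC.
  have n0 := nc_ge0 x.
  exists ((nc x + (nc c)^-1) / 2); split; [lra|lra|].
  rewrite mulrC -ltr_pdivlMr// mul1r; lra.
exists r => //; eexists; first by [].
apply: (@abs_summable_geometric _ _ _ 1 (nc c)) => //; first exact: nc_ge0.
by move=> k; rewrite mul1r ncX.
Qed.

End Scaling.

(** * Passing from z to its root t *)

Section Ramification.
Variables (R : realType) (j : nat).
Local Notation C := R[i].
Local Notation L := (puiseux C).
Implicit Types (x : C) (w : L) (P Q : {poly C}).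

Lemma abs_summable_widen rho (u : nat -> C) : 0 <= rho ->
  abs_summable (rho ^+ j.+1) u -> abs_summable rho (widen_seq j u).
Proof.
move=> rho0 [B uB]; exists B => n; apply: le_trans (uB n).
pose W k := nc (widen_seq j u k) * rho ^+ k.
have W0 k : 0 <= W k by rewrite mulr_ge0 ?nc_ge0 ?exprn_ge0.
apply: le_trans (_ : \sum_(k < n * j.+1) W k <= _).
  have nm : (n <= n * j.+1)%N by rewrite leq_pmulr.
  rewrite -(subnKC nm) big_split_ord /= lerDl.
  by apply: sumr_ge0 => k _; exact: W0.
rewrite le_eqVlt; apply/orP; left; apply/eqP.
elim: n => [|n IH]; first by rewrite !big_ord0.
rewrite mulSn addnC big_split_ord [RHS]big_ord_recr /= IH; congr (_ + _).
rewrite big_ord_recl /= addn0 big1 ?addr0 => [|i _].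
  by rewrite /W /widen_seq dvdn_mull// mulnK// mulnC exprM.
rewrite /W /widen_seq /bump /= dvdn_addr ?dvdn_mull// gtnNdvd// ?nc0 ?mul0r//.
by rewrite add1n ltnS.
Qed.

Lemma holo_widen x w : holo 0 (x ^+ j.+1) w -> holo j x w.
Proof.
move=> [rho xrho [u -> su]]; rewrite ncX in xrho.
have rho0 : 0 < rho by apply: le_lt_trans xrho; rewrite exprn_ge0 ?nc_ge0.
pose r := rho `^ (j.+1%:R^-1); have r0 : 0 < r by rewrite powR_gt0.
have rE : r ^+ j.+1 = rho.
  by rewrite -powR_mulrn ?(ltW r0)// -powRrM mulVf ?pnatr_eq0// powRr1 ?ltW.
exists r; first by
  rewrite -(ltr_pXn2r (ltn0Sn j)) ?nnegrE ?nc_ge0 ?(ltW r0)// rE.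
rewrite (ser_widen j); eexists; first by [].
by apply: abs_summable_widen; rewrite ?rE// ltW.
Qed.

Lemma regular_widen x w : regular 0 (x ^+ j.+1) w -> regular j x w.
Proof.
move=> [Q Qx hw]; exists (Q \Po 'X^(j.+1)); first by rewrite horner_comp hornerXn.
by rewrite -pt_widen; exact: holo_widen.
Qed.

Lemma vanish_widen x w : vanish 0 (x ^+ j.+1) w -> vanish j x w.
Proof.
move=> [w' hw' ->]; rewrite (pt_widen j); apply: vanishMr.
  by apply: vanish_pt; rewrite horner_comp !hornerE subrr.
exact: regular_widen.
Qed.

End Ramification.

(** * Propagation of zeros along a q-spiral *)

Section FiniteType.
Variables (R : realType) (j : nat).
Local Notation C := R[i].
Local Notation L := (puiseux C).
Local Notation pt := (@pt C j).
Implicit Types (x : C) (w : L) (P Q : {poly C}) (U V : seq L).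

(** The C[t]-module generated by [U], in a recursive form that suits the elimination of one
    generator at a time. *)
Fixpoint span U w : Prop :=
  if U is u :: U' then exists P, span U' (w - pt P * u) else w = 0.

Lemma span0 U : span U 0.
Proof. by elim: U => //= u U IH; exists 0; rewrite rmorph0 mul0r subrr. Qed.

Lemma spanD U w w' : span U w -> span U w' -> span U (w + w').
Proof.
elim: U w w' => [|u U IH] w w' /=; first by move=> -> ->; rewrite addr0.
move=> [P hw] [P' hw']; exists (P + P').
have -> : w + w' - pt (P + P') * u = (w - pt P * u) + (w' - pt P' * u).
  by rewrite rmorphD /=; ring.
exact: IH.
Qed.

Lemma spanZ U P w : span U w -> span U (pt P * w).
Proof.
elim: U w => [|u U IH] w /=; first by move=> ->; rewrite mulr0.
move=> [Q hw]; exists (P * Q).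
have -> : pt P * w - pt (P * Q) * u = pt P * (w - pt Q * u).
  by rewrite rmorphM /=; ring.
exact: IH.
Qed.

Lemma span_cons U u w : span U w -> span (u :: U) w.
Proof. by move=> hw; exists 0; rewrite rmorph0 mul0r subr0. Qed.

Lemma span_head U u : span (u :: U) u.
Proof. by exists 1; rewrite rmorph1 mul1r subrr; exact: span0. Qed.

Lemma span_mem U u : u \in U -> span U u.
Proof.
elim: U => // v U IH; rewrite in_cons => /predU1P[->|/IH]; first exact: span_head.
exact: span_cons.
Qed.

Lemma span_catl U V w : span U w -> span (U ++ V) w.
Proof.
elim: U w => [|u U IH] w /=; first by move=> ->; exact: span0.
by move=> [P /IH]; exists P.
Qed.

Lemma span_catr U V w : span V w -> span (U ++ V) w.
Proof. by move=> hw; elim: U => //= u U IH; exact: span_cons. Qed.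

Lemma span_mull U u w : span U w -> span [seq u * v | v <- U] (u * w).
Proof.
elim: U w => [|v U IH] w /=; first by move=> ->; rewrite mulr0.
move=> [P /IH]; rewrite mulrBr [in X in _ -> X]/=; exists P.
by rewrite [pt P * _]mulrCA.
Qed.

Lemma spanM U V w w' : span U w -> span V w' ->
  span [seq u * v | u <- U, v <- V] (w * w').
Proof.
move=> hw hw'; elim: U w hw => [|u U IH] w.
  by move=> /= ->; rewrite mul0r.
move=> [P /IH hw]; rewrite allpairs_cons.
have -> : w * w' = pt P * (u * w') + (w - pt P * u) * w' by ring.
by apply: spanD; [exact/span_catl/spanZ/span_mull | exact: span_catr].
Qed.

Definition combination (Phi : nat -> L) (r : nat) w :=
  exists c : nat -> {poly C}, w = \sum_(m < r) pt (c m) * Phi m.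

Lemma combinationD Phi r w w' : combination Phi r w -> combination Phi r w' ->
  combination Phi r (w + w').
Proof.
move=> [c ->] [c' ->]; exists (fun m => c m + c' m); rewrite -big_split /=.
by apply: eq_bigr => m _; rewrite rmorphD mulrDl.
Qed.

Lemma combination_single Phi r m P : (m < r)%N -> combination Phi r (pt P * Phi m).
Proof.
move=> mr; exists (fun i => if i == m then P else 0).
rewrite (bigD1 (Ordinal mr))//= eqxx big1 ?addr0// => i.
by rewrite -val_eqE /= => /negPf ->; rewrite rmorph0 mul0r.
Qed.

Lemma combination_sum Phi r (s : nat) (F : nat -> L) :
  (forall m, (m < s)%N -> combination Phi r (F m)) ->
  combination Phi r (\sum_(m < s) F m).
Proof.
move=> hF; elim: s hF => [|s IH] hF.
  exists (fun=> 0); rewrite big_ord0 big1// => m _.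
  by rewrite rmorph0 mul0r.
rewrite big_ord_recr /=; apply: combinationD; last exact: hF.
by apply: IH => m ms; apply: hF; rewrite ltnS ltnW.
Qed.

(* Elimination, one generator of U at a time: the denominator is uniform in k. *)
Lemma uniform_denominator U (Phi : nat -> L) : (forall k, span U (Phi k)) ->
  exists r D, D != 0 /\ forall k, combination Phi r (pt D * Phi k).
Proof.
elim: U Phi => [|u U IH] Phi /= hPhi.
  exists 0%N, 1; split=> [|k]; first exact: oner_neq0.
  by exists (fun=> 0); rewrite (hPhi k) big_ord0 mulr0.
have [c cP] := choice hPhi.
have [c0|/existsNP[k0 /eqP ck0]] := pselect (forall k, c k = 0).
  by apply: IH => k; have := cP k; rewrite c0 rmorph0 mul0r subr0.
(* This cross difference has no component along u, so the induction applies to it; solving back for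
   Phi_k multiplies the denominator by [c k0]. *)
pose Phi' k := pt (c k0) * Phi k - pt (c k) * Phi k0.
have [|r [D [D0 hD]]] := IH Phi'.
  move=> k; have -> : Phi' k = pt (c k0) * (Phi k - pt (c k) * u)
                             + pt (- c k) * (Phi k0 - pt (c k0) * u).
    by rewrite /Phi' rmorphN /=; ring.
  by apply: spanD; exact: spanZ.
exists (maxn r k0.+1), (D * c k0); split=> [|k]; first by rewrite mulf_neq0.
have [g gE] := hD k.
have -> : pt (D * c k0) * Phi k = pt (D * c k) * Phi k0
    + \sum_(m < r) (pt (g m * c k0) * Phi m + pt (- (g m * c m)) * Phi k0).
  have -> : pt (D * c k0) * Phi k = pt D * Phi' k + pt (D * c k) * Phi k0.
    by rewrite /Phi' !rmorphM /=; ring.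
  rewrite gE addrC; congr (_ + _); apply: eq_bigr => m _.
  by rewrite /Phi' rmorphN !rmorphM /=; ring.
apply: combinationD; first by apply: combination_single; rewrite leq_max ltnSn orbT.
apply: (@combination_sum Phi _ r
  (fun m => pt (g m * c k0) * Phi m + pt (- (g m * c m)) * Phi k0)) => m mr.
by apply: combinationD; apply: combination_single; rewrite leq_max ?mr ?ltnSn ?orbT.
Qed.

Lemma poly_nonroot P (y : nat -> C) N : injective y -> P != 0 ->
  exists2 k, (N <= k)%N & P.[y k] != 0.
Proof.
move=> yI P0; apply: contrapT => noroot.
have : all (root P) (map (fun k => y (N + k)%N) (iota 0 (size P))).
  apply/allP => _ /mapP[k _ ->]; apply/negPn/negP => Pk.
  by apply: noroot; exists (N + k)%N => //; exact: leq_addr.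
move=> /(max_poly_roots P0); rewrite size_map size_iota ltnn.
rewrite map_inj_uniq ?iota_uniq => [/(_ isT)//|k k' /yI/eqP].
by rewrite eqn_add2l => /eqP.
Qed.

Variables (q0 : C) (qs : nat -> C).
Hypotheses (q00 : q0 != 0) (qsP : compatible_roots q0 qs).
Local Notation p := (qs j.+1).

(** The power of t may depend on k: the iterates lie in one finitely generated module over
    C[t, 1/t]. *)
Definition finite_type w := exists U, forall k, exists e,
  span U (pt 'X^e * iter k (sigma qs) w).

Lemma finite_typeD w w' : finite_type w -> finite_type w' -> finite_type (w + w').
Proof.
move=> [U hU] [V hV]; exists (U ++ V) => k.
have [e he] := hU k; have [e' he'] := hV k; exists (e + e')%N.
have -> : iter k (sigma qs) (w + w') = iter k (sigma qs) w + iter k (sigma qs) w'.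
  by elim: k {he he'} => //= k ->; rewrite sigmaD.
have -> (a b : L) : pt 'X^(e + e') * (a + b) =
    pt 'X^e' * (pt 'X^e * a) + pt 'X^e * (pt 'X^e' * b).
  by rewrite exprD rmorphM /=; ring.
by apply: spanD; apply: spanZ; [exact: span_catl | exact: span_catr].
Qed.

Lemma finite_typeM w w' : finite_type w -> finite_type w' -> finite_type (w * w').
Proof.
move=> [U hU] [V hV]; exists [seq u * v | u <- U, v <- V] => k.
have [e he] := hU k; have [e' he'] := hV k; exists (e + e')%N.
have -> : iter k (sigma qs) (w * w') = iter k (sigma qs) w * iter k (sigma qs) w'.
  by elim: k {he he'} => //= k ->; rewrite (sigmaM q00 qsP).
by rewrite exprD rmorphM /= mulrACA; exact: spanM.
Qed.

Lemma finite_type_pt P : finite_type (pt P).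
Proof.
exists [:: 1] => k; exists 0%N; rewrite expr0 rmorph1 mul1r.
suff [Q ->] : exists Q, iter k (sigma qs) (pt P) = pt Q.
  by exists Q; rewrite mulr1 subrr.
elim: k => [|k [Q IH]]; first by exists P.
by rewrite /= IH (sigma_pt j Q qsP); eexists.
Qed.

(** By [uniform_denominator], a nonzero multiple of each iterate w(p^m t) is a combination of the
    first s iterates. At a point tau p^-k far enough out these s vanish, hence so do all; thus w
    vanishes at every p^m tau p^-k. These points tend to 0, against [vanish_near0]. *)
Lemma finite_type_eq0 (tau : C) rho w : tau != 0 -> nc p < 1 ->
    0 < rho -> on_disc j rho w -> finite_type w ->
  forall k0, (forall k, (k0 <= k)%N -> vanish j (tau * p ^- k) w) -> w = 0.
Proof.
move=> tau0 p1 rho0 hw [U hU] k0 wk; apply/eqP/negPn/negP => w0.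
have [r r0 rP] := vanish_near0 rho0 hw w0.
have p0 : p != 0 by apply: (qs_neq0 q00 qsP).
have np0 : 0 < nc p by rewrite nc_gt0.
have [e eP] := choice hU.
have [s [D [D0 sD]]] := uniform_denominator eP.
have tI : injective (fun k => tau * p ^- k).
  by move=> k k' /(mulfI tau0)/invr_inj/(nc_exp_inj np0 p1).
(* With k >= k0 + s, each i < s satisfies k - i >= k0, so w vanishes at tau p^-(k-i). *)
have [k kk Dk] := poly_nonroot (k0 + s) tI D0.
have tk0 : tau * p ^- k != 0 by rewrite mulf_neq0// invr_eq0 expf_neq0.
have vk m : vanish j (p ^+ m * (tau * p ^- k)) w.
  apply: (vanish_sigma_iterV q00 qsP).
  have XD : (D * 'X^(e m)).[tau * p ^- k] != 0.
    by rewrite hornerM hornerXn mulf_neq0// expf_neq0.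
  apply: (vanish_cancel XD); rewrite rmorphM /= -mulrA; have [c ->] := sD m.
  apply: vanish_sum => i _; do 2 (apply: vanishMl; first exact: regular_pt).
  apply: (vanish_sigma_iter q00 qsP); rewrite mulrCA.
  have ik : (i <= k)%N.
    by rewrite (leq_trans (ltnW (ltn_ord i)))// (leq_trans _ kk)// leq_addl.
  rewrite -{1}(subnKC ik) exprD invfM mulVKf ?expf_neq0//.
  by apply: wk; rewrite leq_subRL// addnC (leq_trans _ kk)// leq_add2l ltnW.
have t0 : 0 < nc (tau * p ^- k) by rewrite nc_gt0.
have [m pm] : exists m, nc p ^+ m * nc (tau * p ^- k) < r.
  apply: contrapT => /forallNP hm.
  suff /eqP : r / nc (tau * p ^- k) = 0 by rewrite gt_eqF// divr_gt0.
  apply: (expr_archi (ltW np0) p1 (B := 1)); first by rewrite divr_ge0 ?ltW.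
  by move=> m; rewrite mul1r ler_pdivrMr// leNgt; exact/negP/hm.
apply: (rP _ _ _ (vk m)); first by rewrite mulf_neq0// expf_neq0.
by rewrite ncM ncX.
Qed.

End FiniteType.

(** * The equation B(x) u(qx) = A(x) u(x) *)

Lemma transport_inv (F : fieldType) (x y w s s' : F) : w != 0 -> s * s' = 1 ->
  y * s = x * w -> x * s' = y * w^-1.
Proof. by move=> w0 ss' e; apply: (mulIf w0); rewrite mulfVK// mulrAC -e -mulrA ss' mulr1. Qed.

Section QProduct.
Variables (R : realType) (q : R[i]) (qs : nat -> R[i]).
Hypotheses (q0 : q != 0) (q1 : nc q < 1) (qsP : compatible_roots q qs).
Local Notation C := R[i].
Local Notation L := (puiseux C).
Local Notation pt := (@pt C 0).
Local Notation ser := (@ser C 0).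
Local Notation sg := (sigma qs).
Implicit Types (P Q : {poly C}) (u : nat -> C).

Lemma qs1 : qs 1%N = q.
Proof. by have := qsP.1 1%N isT; rewrite expr1. Qed.

Definition unit_series w := exists u rho,
  [/\ w = ser u, u 0%N != 0, 0 < rho & abs_summable rho u].

Lemma unit_seriesM w w' : unit_series w -> unit_series w' -> unit_series (w * w').
Proof.
move=> [u [r [-> u0 r0 su]]] [v [r' [-> v0 r'0 sv]]].
exists (Defs.conv u v), (Num.min r r'); rewrite -serM; split=> //.
- by rewrite /Defs.conv big_ord1 mulf_neq0.
- by rewrite lt_min r0.
have m0 : 0 <= Num.min r r' by rewrite le_min !ltW.
apply: abs_summableM => //.
  by apply: abs_summable_le su; rewrite // ge_min lexx.
by apply: abs_summable_le sv; rewrite // ge_min lexx orbT.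
Qed.

Lemma unit_series_neq0 w : unit_series w -> w != 0.
Proof.
move=> [u [_ [-> u0 _ _]]]; apply: contraNneq u0; rewrite -(ser0 _ 0).
by move=> /ser_inj ->.
Qed.

Lemma unit_seriesV w : unit_series w -> unit_series w^-1.
Proof.
move=> uw; have w0 := unit_series_neq0 uw.
have [u [r [wE u0 r0 su]]] := uw; have [r' r'0 [v wV sv]] := on_disc_inv 0 r0 u0 su.
exists v, r'; split=> //; first by rewrite wE.
have /(congr1 (fun z : L => pcoef z 0)) : w * w^-1 = 1 by rewrite divff.
rewrite -(ser1 _ 0) wE wV -serM -[0 : rat](mul0r (1%N%:R^-1)) -[X in X / _]/(0%N%:R).
rewrite !pcoef_ser /Defs.conv big_ord1 /Defs.conv1 eqxx => e.
by apply: contra_eq_neq e => ->; rewrite mulr0 eq_sym oner_neq0.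
Qed.

(** A convergent solution of Q(x) w(qx) = P(x) w(x). Asking for w(0) nonzero makes solutions stable
    under products and quotients. *)
Definition solves P Q w := unit_series w /\ pt Q * sg w = pt P * w.

Lemma solvesM P Q w P' Q' w' : solves P Q w -> solves P' Q' w' ->
  solves (P * P') (Q * Q') (w * w').
Proof.
move=> [uw e] [uw' e']; split; first exact: unit_seriesM.
by rewrite (sigmaM q0 qsP) !rmorphM /= mulrACA e e' mulrACA.
Qed.

Lemma solvesV P Q w : solves P Q w -> solves Q P w^-1.
Proof.
move=> [uw e]; split; first exact: unit_seriesV.
have w0 := unit_series_neq0 uw.
have sw : sg w * sg w^-1 = 1 by rewrite -(sigmaM q0 qsP) divff ?(sigma1 qsP).
exact: transport_inv w0 sw e.
Qed.

Lemma solves1 : solves 1 1 1.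
Proof.
split; last by rewrite (sigma1 qsP).
exists (@Defs.conv1 C), 1; rewrite ser1 /Defs.conv1 eqxx oner_neq0 ltr01; split=> //.
have -> : (fun k => (k == 0%N)%:R) = (fun k => (1 : {poly C})`_k).
  by apply/funext => k; rewrite coef1.
exact: abs_summable_poly.
Qed.

Lemma one_subr_q_neq0 k : 1 - q ^+ k.+1 != 0.
Proof.
rewrite subr_eq0; apply/eqP => /esym/(congr1 (@nc R)); rewrite ncX nc1 => e.
have : nc q ^+ k.+1 < 1 by rewrite exprn_ilt1 ?nc_ge0.
by rewrite e ltxx.
Qed.

(* The q-exponential 1 / (c X; q)_oo. *)
Lemma solves_linear (c : C) : exists w, solves (1 - c *: 'X) 1 w.
Proof.
pose e k := c ^+ k / \prod_(i < k) (1 - q ^+ i.+1); exists (ser e); split; last first.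
  rewrite rmorph1 mul1r (sigma_ser 0 e qsP) qs1.
  rewrite rmorphB rmorph1 mulrBl mul1r -mul_polyC rmorphM /= -mulrA.
  rewrite -['X]expr1 pt_Xn_ser pt_C_ser -serN -serD; congr ser.
  apply/funext => k.
  rewrite -[RHS]/(e k - c * (if (k < 1)%N then 0 else e (k - 1)%N)).
  case: k => [|k]; first by rewrite mulr0 subr0 mul1r.
  rewrite subn1 /= /e big_ord_recr /= [c ^+ k.+1]exprS.
  field; rewrite one_subr_q_neq0 andbT; apply/prodf_neq0 => i _.
  exact: one_subr_q_neq0.
have d0 : 0 < 1 - nc q by rewrite subr_gt0.
(* Since |1 - q^i| >= 1 - |q| for i >= 1, the coefficients are at most (|c| / (1 - |q|))^k, and this
   radius makes the ratio less than 1, also when c = 0. *)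
pose rho := (1 - nc q) / (nc c + 1).
have c1 : 0 < nc c + 1 by rewrite ltr_wpDl ?nc_ge0.
exists e, rho; split=> //.
- by rewrite /e big_ord0 expr0 divr1 oner_neq0.
- by rewrite divr_gt0.
apply: (@abs_summable_geometric _ _ _ 1 (nc c / (1 - nc q))).
- by rewrite divr_ge0// ltW.
- by rewrite divr_ge0 ?nc_ge0// ltW.
- rewrite /rho mulrA divfK ?gt_eqF// ltr_pdivrMr// mul1r; lra.
move=> k; rewrite /e mul1r ncM ncX ncV exprMn exprVn ler_wpM2l ?exprn_ge0 ?nc_ge0//.
rewrite lef_pV2 ?posrE ?exprn_gt0//; last first.
  by rewrite nc_gt0; apply/prodf_neq0 => i _; exact: one_subr_q_neq0.
elim: k => [|k IH]; first by rewrite big_ord0 nc1.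
rewrite big_ord_recr /= ncM exprSr ler_pM ?exprn_ge0 ?(ltW d0)//.
have n1 : nc 1 <= nc (1 - q ^+ k.+1) + nc (q ^+ k.+1).
  by rewrite -{1}[1](subrK (q ^+ k.+1)) ncD.
rewrite nc1 ncX in n1.
have n2 : nc q ^+ k.+1 <= nc q.
  by rewrite exprS ler_piMr ?nc_ge0// exprn_ile1 ?nc_ge0 ?ltW.
lra.
Qed.

Lemma solves_prod (I : finType) (c : I -> C) :
  exists w, solves (\prod_i (1 - c i *: 'X)) 1 w.
Proof.
elim/big_rec: _ => [|i P _ [w hw]]; first by exists 1; exact: solves1.
have [w' hw'] := solves_linear (c i); exists (w' * w).
by rewrite -[X in solves _ X](mulr1 1); exact: solvesM.
Qed.

(** The solution is a quotient of two products of q-exponentials. *)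
Lemma q_product_ex (I J : finType) (a : I -> C) (b : J -> C) :
  exists w, solves (\prod_i (1 - a i *: 'X)) (\prod_j (1 - b j *: 'X)) w.
Proof.
have [w hw] := solves_prod a; have [w' hw'] := solves_prod b.
exists (w / w'); rewrite -[X in solves X]mulr1 -[X in solves _ X](mul1r _).
exact: (solvesM hw (solvesV hw')).
Qed.

End QProduct.

Lemma Re_le_nc (R : realType) (x : R[i]) : complex.Re x <= nc x.
Proof.
case: x => c d /=; apply: le_trans (ler_norm _) _.
by rewrite -sqrtr_sqr /nc /= ler_wsqrtr// lerDl sqr_ge0.
Qed.

Lemma pow_small (R : realType) (th : R) : 0 <= th -> th < 1 -> forall r e, 0 < e ->
  exists m, forall k, (m <= k)%N -> r * th ^+ k < e.
Proof.
move=> th0 th1 r e e0; have [r0|r0] := leP r 0.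
  by exists 0%N => k _; apply: le_lt_trans e0; rewrite mulr_le0_ge0// exprn_ge0.
suff [m hm] : exists m, r * th ^+ m < e.
  exists m => k mk; apply: le_lt_trans hm; rewrite ler_wpM2l ?(ltW r0)//.
  by rewrite -(subnKC mk) exprD ler_piMr ?exprn_ge0// exprn_ile1// ltW.
apply: contrapT => /forallNP hm; suff /eqP : e = 0 by rewrite gt_eqF.
apply: (expr_archi th0 th1 (B := r) (ltW e0)) => m.
by rewrite leNgt; exact/negP/hm.
Qed.

(** * Nonvanishing of the coefficients of a solution *)

Section Coefficients.
Variables (R : realType) (q : R[i]) (qs : nat -> R[i]).
Hypotheses (q0 : q != 0) (q1 : nc q < 1) (qsP : compatible_roots q qs).
Variables (I J : finType) (a : I -> R[i]) (b : J -> R[i]) (u : nat -> R[i]).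
Local Notation C := R[i].
Local Notation L := (puiseux C).
Local Notation pt := (@pt C 0).
Local Notation ser := (@ser C 0).
Local Notation sg := (sigma qs).
Local Notation A := (\prod_i (1 - a i *: 'X)).
Local Notation B := (\prod_j (1 - b j *: 'X)).
Hypothesis uP : solves qs A B (ser u).

Let qsE : qs 1%N = q. Proof. exact: qs1 qsP. Qed.
Let q_pow_small := pow_small (nc_ge0 q) q1.

Lemma holo_inv_prod x (P : pred I) :
  (forall i, P i -> nc (a i) * nc x < 1) ->
  holo 0 x (pt (\prod_(i | P i) (1 - a i *: 'X)))^-1.
Proof.
move=> ax; elim/big_rec: _ => [|i Q Pi hQ].
  by rewrite rmorph1 invr1 -(rmorph1 pt); exact: holo_pt.
by rewrite rmorphM invfM; apply: holoM => //; apply: holo_geometric; exact: ax.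
Qed.

Lemma horner_prod_neq0 (K : finType) (c : K -> C) x (P : pred K) :
  (forall i, P i -> c i * x != 1) ->
  (\prod_(i | P i) (1 - c i *: 'X)).[x] != 0.
Proof.
move=> cx; rewrite horner_prod; apply/prodf_neq0 => i Pi.
by rewrite !hornerE subr_eq0 eq_sym cx.
Qed.

Lemma pt_prod_neq0 (K : finType) (c : K -> C) (P : pred K) :
  pt (\prod_(i | P i) (1 - c i *: 'X)) != 0.
Proof.
by apply: (@pt_neq0 _ _ 0); apply: horner_prod_neq0 => i _; rewrite mulr0 eq_sym oner_neq0.
Qed.

(** The equation u(x) = B(x) u(qx) / A(x) extends u from the disc of radius |qx| to that of radius
    |x| as long as A has no zero there; after M steps one is in the initial disc of convergence. *)
Lemma holo_solution x : (forall i, nc (a i) * nc x < 1) -> holo 0 x (ser u).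
Proof.
have [[v [rho [/ser_inj <- _ rho0 su]]] uE] := uP => ax.
have [M /(_ M (leqnn _)) xM] := q_pow_small (nc x) rho0.
elim: M x ax xM => [|M IH] x ax xM.
  by rewrite expr0 mulr1 in xM; exists rho => //; exists u.
have -> : ser u = (pt A)^-1 * (pt B * sg (ser u)).
  by rewrite uE mulKf ?pt_prod_neq0.
apply: holoM; first exact: holo_inv_prod.
apply: holoM; first exact: holo_pt.
apply: (holo_sigma q0 qsP); rewrite qsE; apply: IH.
  move=> i; apply: le_lt_trans (ax i); rewrite ncM ler_wpM2l ?nc_ge0//.
  by rewrite ler_piMl ?nc_ge0// ltW.
by rewrite ncM [nc q * _]mulrC -mulrA -exprS.
Qed.

Lemma vanish_solution_step x : (forall j, b j * x != 1) ->
  vanish 0 x (ser u) -> vanish 0 (q * x) (ser u).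
Proof.
have [_ uE] := uP => bx vx; rewrite -qsE; apply: (vanish_sigmaV q0 qsP).
apply: (@vanish_cancel _ _ _ B); first exact: horner_prod_neq0.
by rewrite uE; apply: vanishMl => //; exact: regular_pt.
Qed.

Lemma vanish_solution_near0 : exists m, forall k, (m <= k)%N ->
  forall x, x != 0 -> nc x <= nc q ^+ k -> ~ vanish 0 x (ser u).
Proof.
have [[v [rho [/ser_inj <- u0 rho0 su]]] _] := uP.
have su0 : ser u != 0.
  by apply: contraNneq u0; rewrite -(ser0 _ 0) => /ser_inj ->.
have ou : on_disc 0 rho (ser u) by exists u.
have [r r0 rP] := vanish_near0 rho0 ou su0.
have [m mP] := q_pow_small 1 r0; exists m => k mk x x0 xk; apply: rP => //.
by apply: le_lt_trans xk _; rewrite -[ltLHS]mul1r; exact: mP.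
Qed.

(* Stable under partial sums, as opposed to having a nonzero limit. *)
Definition half_plane (v : nat -> C) := exists (c : C) (N : nat) (e : R),
  0 < e /\ forall k, (N <= k)%N -> e <= complex.Re (c * v k).

(** From some index on, the real part of c v'_k grows by at least e at each step, hence ends up
    above e. *)
Lemma half_plane_sums (v v' : nat -> C) : half_plane v ->
  (forall k, v' k.+1 = v' k + v k.+1) -> half_plane v'.
Proof.
have ReD (y z : C) : complex.Re (y + z) = complex.Re y + complex.Re z.
  by case: y z => [? ?] [].
move=> [c [N [e [e0 vP]]]] v'E; pose f k := complex.Re (c * v' k).
have fE k : (N <= k)%N -> f k + e <= f k.+1.
  by move=> Nk; rewrite /f v'E mulrDr ReD lerD2l vP// ltnW.
have fD d : f N + d%:R * e <= f (N + d)%N.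
  elim: d => [|d IH]; first by rewrite mul0r addr0 addn0.
  rewrite addnS; apply: le_trans (fE _ (leq_addr _ _)).
  by rewrite -natr1 mulrDl mul1r addrA lerD2r.
pose D := Num.bound ((e - f N) / e).
exists c, (N + D)%N, e; split=> // k Nk.
rewrite -[k](subnKC Nk) -addnA; apply: le_trans (fD _).
rewrite -lerBlDl -ler_pdivrMr//; apply: le_trans (_ : D%:R <= _); last first.
  by rewrite ler_nat leq_addr.
have [le0|gt0] := leP ((e - f N) / e) 0; first exact: le_trans le0 (ler0n _ _).
by apply/ltW/archi_boundP/ltW.
Qed.

(** Dividing a series by 1 - c t replaces its coefficients, normalised by c^-k, by their partial
    sums. *)
Lemma half_plane_iter (c : C) m (S v : nat -> C) : c != 0 ->
  pt (1 - c *: 'X) ^+ m * ser v = ser S ->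
  half_plane (fun k => S k * c ^- k) -> half_plane (fun k => v k * c ^- k).
Proof.
move=> c0; elim: m v => [|m IH] v; first by rewrite mul1r => /ser_inj ->.
have [v' v'E] : exists v', pt (1 - c *: 'X) * ser v = ser v'.
  by eexists; rewrite -serM.
rewrite exprSr -mulrA v'E => e hS; have := IH v' e hS.
move=> /half_plane_sums; apply => k.
have vE : v' k.+1 = v k.+1 - c * v k.
  move: v'E; rewrite rmorphB rmorph1 mulrBl mul1r -mul_polyC rmorphM /= -mulrA.
  rewrite -['X]expr1 pt_Xn_ser pt_C_ser -serN -serD => /ser_inj <-.
  by rewrite -[LHS]/(v k.+1 - c * v (k.+1 - 1)%N) subn1.
by rewrite vE exprS; field; rewrite c0 expf_neq0.
Qed.

(** Let c be the dominant a_i, of multiplicity mu, and x0 = 1/c. Then G = (1 - c t)^mu u is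
    holomorphic and nonzero at x0, so (1 - c t)^(mu-1) u has coefficients asymptotic to a nonzero
    multiple of c^k. The remaining mu - 1 divisions by 1 - c t preserve [half_plane], which excludes
    zero coefficients of large index. *)
Lemma solution_coef_neq0 (i0 : I) :
    a i0 != 0 -> (forall i, nc (a i) <= nc (a i0)) ->
    (forall i, nc (a i) = nc (a i0) -> a i = a i0) ->
    (forall j m, b j * q ^+ m != a i0) ->
  exists N, forall k, (N <= k)%N -> u k != 0.
Proof.
move=> a0 a_max a_eq ba; have [_ uE] := uP.
set c := a i0 in a0 a_max a_eq ba *; pose x0 := c^-1.
have x00 : x0 != 0 by rewrite invr_eq0.
have nc_c : 0 < nc c by rewrite nc_gt0.
have nq0 : 0 < nc q by rewrite nc_gt0.
pose mu := #|[pred i | a i == c]|.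
pose A' : {poly C} := \prod_(i | a i != c) (1 - a i *: 'X).
have AE : A = (1 - c *: 'X) ^+ mu * A'.
  rewrite (bigID (fun i => a i == c)) /=; congr (_ * _).
  rewrite -prodr_const; apply: eq_big => [i|i /eqP ->//].
  by rewrite inE.
have mu0 : (0 < mu)%N by apply/card_gt0P; exists i0; rewrite inE.
pose G := pt (1 - c *: 'X) ^+ mu * ser u.
have GE : pt A' * G = pt B * sg (ser u).
  by rewrite uE AE rmorphM rmorphXn /G /= mulrCA mulrA.
have hG : holo 0 x0 G.
  have -> : G = (pt A')^-1 * (pt B * sg (ser u)).
    by rewrite -GE mulKf ?pt_prod_neq0.
  apply: holoM.
    apply: holo_inv_prod => i aic; rewrite ncV -ltr_pdivlMr ?invr_gt0// invrK mul1r.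
    by rewrite lt_neqAle a_max andbT; apply: contra_neq aic => /a_eq.
  apply: holoM; first exact: holo_pt.
  apply: (holo_sigma q0 qsP); rewrite qsE; apply: holo_solution => i.
  apply: le_lt_trans q1; rewrite ncM ncV mulrCA ler_piMr ?nc_ge0//.
  by rewrite ler_pdivrMr// mul1r.
(* A zero of G at x0 gives a zero of u at q x0, which the equation carries to all q^(k+1) x0, as B
   is nonzero at every q^k x0; but u has no zeros near 0. *)
have vG : ~ vanish 0 x0 G.
  move=> vG; have v1 : vanish 0 (q * x0) (ser u).
    rewrite -qsE; apply: (vanish_sigmaV q0 qsP).
    apply: (@vanish_cancel _ _ _ B).
      apply: horner_prod_neq0 => j _; rewrite -(divff a0).
      by rewrite (inj_eq (mulIf x00)); have := ba j 0%N; rewrite mulr1.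
    by rewrite -GE; apply: vanishMl => //; exact: regular_pt.
  have vk k : vanish 0 (q ^+ k.+1 * x0) (ser u).
    elim: k => [|k IH]; first by rewrite expr1.
    rewrite exprS -mulrA; apply: vanish_solution_step => // j.
    by rewrite mulrA -(divff a0) (inj_eq (mulIf x00)); exact: ba.
  have [m mP] := vanish_solution_near0.
  have [m' m'P] := q_pow_small (nc x0) (exprn_gt0 m nq0).
  apply: (mP m (leqnn m) _ _ _ (vk m')).
    by rewrite mulf_neq0// expf_neq0.
  by rewrite ncM ncX mulrC ltW// m'P// leqnSn.
have [rho xrho [v vE sv]] := hG; have [T vT] := sv.
have [e [w [hw we _]]] := value_ex 0 x00 xrho vT.
have e0 : e != 0.
  apply: contra_notN vG => /eqP e00; rewrite vE we e00 rmorph0 add0r.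
  by exists w => //; exact: holo_regular.
have [r xr [W wE sW]] := hw.
(* From G = e + (t - x0) w and t - x0 = - x0 (1 - c t), one gets G / (1 - c t) = e / (1 - c t) - x0
   w. *)
pose S k := e * c ^+ k - x0 * W k.
have SE : pt (1 - c *: 'X) ^+ mu.-1 * ser u = ser S.
  have P0 : pt (1 - c *: 'X) != 0.
    by rewrite (@pt_neq0 _ _ 0)// !hornerE ?mulr0 ?subr0 oner_neq0.
  apply: (mulfI P0); rewrite mulrA -exprS prednK// -/G vE we wE.
  have -> : ser S = pt e%:P * (pt (1 - c *: 'X))^-1 - pt x0%:P * ser W.
    by rewrite pt_geometric !pt_C_ser -serN -serD.
  have -> : 'X - x0%:P = - ((1 - c *: 'X) * x0%:P).
    rewrite mulrBl mul1r -mul_polyC -mulrA ['X * _]mulrC mulrA -polyCM divff//.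
    by rewrite mul1r opprB.
  by rewrite mulrBr (mulrCA (pt (1 - c *: 'X))) divff// mulr1 rmorphN rmorphM mulNr -mulrA.
have hS : half_plane (fun k => S k * c ^- k).
  have r0 : 0 < r by apply: le_lt_trans xr; exact: nc_ge0.
  have [K K0 WK] := abs_summable_bound (ltW r0) sW.
  have ne0 : 0 < nc e by rewrite nc_gt0.
  have xr1 : nc x0 / r < 1 by rewrite ltr_pdivrMr// mul1r.
  have xr0 : 0 <= nc x0 / r by rewrite divr_ge0 ?nc_ge0 ?ltW.
  have h2 : (0 : R) < 2^-1 by rewrite invr_gt0.
  have [N hN] := pow_small xr0 xr1 (nc x0 * K / nc e) h2.
  exists e^-1, N, 2^-1; split=> [|k Nk]; first by rewrite invr_gt0.
  have -> : e^-1 * (S k * c ^- k) = 1 - e^-1 * (x0 * (W k * x0 ^+ k)).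
    by rewrite /S exprVn; field; rewrite e0 expf_neq0.
  have ReB (y z : C) : complex.Re (y - z) = complex.Re y - complex.Re z.
    by case: y z => [? ?] [].
  rewrite ReB /= lerBrDr; set y := e^-1 * _.
  suff : nc y <= 2^-1 by have := Re_le_nc y; lra.
  apply: le_trans (ltW (hN k Nk)).
  rewrite /y !ncM ncV ncX.
  have -> : nc x0 * K / nc e * (nc x0 / r) ^+ k =
      (nc e)^-1 * (nc x0 * (K / r ^+ k * nc x0 ^+ k)).
    by rewrite exprMn exprVn; ring.
  rewrite ler_wpM2l ?invr_ge0 ?nc_ge0// ler_wpM2l ?nc_ge0//.
  by rewrite ler_wpM2r ?exprn_ge0 ?nc_ge0// ler_pdivlMr ?exprn_gt0// WK.
have [c' [N [d [d0 hN]]]] := half_plane_iter a0 SE hS.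
exists N => k /hN; apply: contraTneq => ->.
by rewrite mul0r mulr0 /= -ltNge.
Qed.

End Coefficients.

(** * Mittag-Leffler decomposition *)

Section MittagLeffler.
Variables (R : realType) (q : R[i]) (qs : nat -> R[i]).
Hypotheses (q0 : q != 0) (q1 : nc q < 1) (qsP : compatible_roots q qs).
Variables (I J : finType) (a : I -> R[i]) (b : J -> R[i]) (u : nat -> R[i]).
Local Notation C := R[i].
Local Notation L := (puiseux C).
Local Notation pt := (@pt C 0).
Local Notation ser := (@ser C 0).
Local Notation sg := (sigma qs).
Local Notation A := (\prod_i (1 - a i *: 'X)).
Local Notation B := (\prod_j (1 - b j *: 'X)).
Hypothesis uP : solves qs A B (ser u).
Variables (d : nat -> C) (lambda : C).
Hypotheses (lambda0 : lambda != 0) (d0 : forall m, d m != 0).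
Hypothesis dP : forall m, B.[q ^+ m] * d m.+1 = A.[q ^+ m] * d m.
Hypothesis Bq : forall m, B.[q ^+ m] != 0.

Let qsE : qs 1%N = q. Proof. exact: qs1 qsP. Qed.

(* d m is a constant multiple of the value at q^m of the solution u. *)
Lemma coef_value : exists (kappa : C) (K rho : R) (m0 : nat),
  [/\ kappa != 0, 0 < rho & forall m M, (m0 <= m)%N ->
    nc (d m - kappa * \sum_(k < M) u k * (q ^+ m) ^+ k)
      <= K * (nc q ^+ m / rho) ^+ M].
Proof.
have [[u' [rho [/ser_inj <- u0 rho0 [T uT]]]] uE] := uP.
have [m1 m1P] := pow_small (nc_ge0 q) q1 1 rho0.
have xm m : q ^+ m != 0 by rewrite expf_neq0.
have small m : (m1 <= m)%N -> nc (q ^+ m) < rho.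
  by move=> /m1P; rewrite mul1r ncX.
have /choice[v vP] : forall m, exists v : C, (m1 <= m)%N ->
    vanish 0 (q ^+ m) (ser u - pt v%:P) /\ forall M,
    nc (v - \sum_(k < M) u k * (q ^+ m) ^+ k) <= 2 * T * (nc q ^+ m / rho) ^+ M.
  move=> m; have [/small mr|lt_m] := leqP m1 m; last by exists 0.
  have [v [w [hw we vB]]] := value_ex 0 (xm m) mr uT.
  exists v => _; split; last by move=> M; rewrite -ncX.
  by rewrite we addrAC subrr add0r; exists w => //; exact: holo_regular.
have vS m : (m1 <= m)%N -> B.[q ^+ m] * v m.+1 = A.[q ^+ m] * v m.
  move=> mm; have [v1 _] := vP _ mm; have [v2 _] := vP _ (leqW mm).
  apply/eqP; rewrite -subr_eq0; apply/eqP.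
  apply: (@vanish_const _ 0 (q ^+ m)).
  have v2' : vanish 0 (q ^+ m) (sg (ser u) - pt (v m.+1)%:P).
    have -> : sg (ser u) - pt (v m.+1)%:P = sg (ser u - pt (v m.+1)%:P).
      by rewrite -rmorphN -polyCN (sigmaD qs) (sigma_pt 0 _ qsP) comp_polyC.
    by apply: (vanish_sigma q0 qsP); rewrite qsE -exprS.
  (* The functional equation evaluated at q^m: as A u = B u(q t), the constant is a sum of terms
     that all vanish at q^m. *)
  have -> : pt (B.[q ^+ m] * v m.+1 - A.[q ^+ m] * v m)%:P =
      pt A * (ser u - pt (v m)%:P) - pt B * (sg (ser u) - pt (v m.+1)%:P)
      + (pt (v m)%:P * pt (A - A.[q ^+ m]%:P)
         - pt (v m.+1)%:P * pt (B - B.[q ^+ m]%:P)).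
    rewrite [pt B * (_ - _)]mulrBr uE polyCB !polyCM !(rmorphB, rmorphM) /=.
    by ring.
  apply: vanishD; apply: vanishB; apply: vanishMl => //; try exact: regular_pt.
    by apply: vanish_pt; rewrite hornerD hornerN hornerC subrr.
  by apply: vanish_pt; rewrite hornerD hornerN hornerC subrr.
(* Beyond m2, u has no zero at q^m. So v_(m0) is nonzero, and d and v, obeying the same recursion of
   order one, are proportional from m0 on. *)
have [m2 m2P] := vanish_solution_near0 q1 uP.
pose m0 := maxn m1 m2; have m10 : (m1 <= m0)%N by rewrite leq_maxl.
have v0 : v m0 != 0.
  have [vm0 _] := vP _ m10.
  apply: contra_notN (m2P m0 (leq_maxr _ _) _ (xm m0) _) => [/eqP v00|].
    by move: vm0; rewrite v00 rmorph0 subr0.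
  by rewrite ncX.
have dv k : d (m0 + k)%N * v m0 = d m0 * v (m0 + k)%N.
  elim: k => [|k IH]; first by rewrite addn0.
  apply: (mulfI (Bq (m0 + k))); rewrite addnS mulrA dP -mulrA IH.
  rewrite [RHS]mulrCA vS 1?mulrCA//.
  by rewrite (leq_trans m10)// leq_addr.
exists (d m0 / v m0), (nc (d m0 / v m0) * (2 * T)), rho, m0; split=> // [|m M mm].
  by rewrite mulf_neq0// invr_eq0.
have -> : d m = d m0 / v m0 * v m.
  by apply: (mulIf v0); rewrite -(subnKC mm) dv mulrAC divfK.
move: (d m0 / v m0) => kappa; rewrite -mulrBr ncM -[leRHS]mulrA ler_wpM2l ?nc_ge0//.
by apply: (vP m _).2; apply: leq_trans mm.
Qed.

Local Notation f := (ser (fun m => d m * lambda ^+ m)).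
Local Notation pole k := (1 - (lambda * q ^+ k) *: 'X : {poly C}).

(** Expanding d_m as kappa times the sum of u_k q^(mk) and summing lambda^m d_m z^m over m first
    gives the polar parts kappa u_k / (1 - lambda q^k z). By [coef_value], removing M of them leaves
    coefficients that are O(|lambda q^M|^m). *)
Lemma mittag_leffler : exists2 kappa : C, kappa != 0 & forall M y,
  nc (lambda * q ^+ M) * nc y < 1 ->
  holo 0 y (f - \sum_(k < M) pt (kappa * u k)%:P * (pt (pole k))^-1).
Proof.
have [kappa [K [rho [m0 [kappa0 rho0 dK]]]]] := coef_value.
exists kappa => // M y yM; set th := nc (lambda * q ^+ M) in yM.
have th0 : 0 < th by rewrite nc_gt0 mulf_neq0// expf_neq0.
pose tail m := d m * lambda ^+ m -
  \sum_(k < M) kappa * u k * (lambda * q ^+ k) ^+ m.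
have -> : f - \sum_(k < M) pt (kappa * u k)%:P * (pt (pole k))^-1 = ser tail.
  have sumE : \sum_(k < M) pt (kappa * u k)%:P * (pt (pole k))^-1 =
      ser (fun m => \sum_(k < M) kappa * u k * (lambda * q ^+ k) ^+ m).
    elim: (M) => [|N IH].
      rewrite big_ord0 -(ser0 _ 0); congr ser; apply/funext => m.
      by rewrite big_ord0.
    rewrite big_ord_recr /= IH pt_geometric pt_C_ser -serD.
    by congr ser; apply/funext => m; rewrite big_ord_recr.
  by rewrite sumE -serN -serD.
have tailB m : (m0 <= m)%N -> nc (tail m) <= K / rho ^+ M * th ^+ m.
  move=> mm; have -> : tail m =
      lambda ^+ m * (d m - kappa * \sum_(k < M) u k * (q ^+ m) ^+ k).
    rewrite /tail mulrBr [d m * _]mulrC; congr (_ - _).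
    rewrite !mulr_sumr; apply: eq_bigr => k _.
    by rewrite exprMn -!exprM [(k * m)%N]mulnC; ring.
  rewrite ncM ncX; apply: le_trans (ler_wpM2l (exprn_ge0 _ (nc_ge0 _)) (dK m M mm)) _.
  rewrite /th ncM ncX exprMn exprMn exprVn -!exprM [(m * M)%N]mulnC.
  by rewrite le_eqVlt; apply/orP; left; apply/eqP; ring.
(* The added sum absorbs the first m0 coefficients, for which there is no estimate. *)
pose K' := K / rho ^+ M + \sum_(m < m0) nc (tail m) / th ^+ m.
have K0 : 0 <= K / rho ^+ M.
  have := tailB m0 (leqnn _); rewrite -ler_pdivrMr ?exprn_gt0//.
  by apply: le_trans; rewrite divr_ge0 ?nc_ge0 ?exprn_ge0 ?ltW.
have s0 m : 0 <= nc (tail m) / th ^+ m by rewrite divr_ge0 ?nc_ge0 ?exprn_ge0 ?ltW.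
have tailB' m : nc (tail m) <= K' * th ^+ m.
  rewrite /K' mulrDl; have [mm|mm] := leqP m0 m.
    apply: le_trans (tailB m mm) _; rewrite lerDl mulr_ge0 ?exprn_ge0 ?(ltW th0)//.
    by apply: sumr_ge0 => i _; exact: s0.
  apply: le_trans (_ : (\sum_(m < m0) nc (tail m) / th ^+ m) * th ^+ m <= _); last first.
    by rewrite lerDr mulr_ge0 ?exprn_ge0 ?(ltW th0).
  rewrite -ler_pdivrMr ?exprn_gt0// (bigD1 (Ordinal mm))//= lerDl.
  by apply: sumr_ge0 => i _; exact: s0.
have yth : nc y < th^-1 by rewrite -[th^-1]mul1r ltr_pdivlMr// mulrC.
have y0 := nc_ge0 y.
exists ((nc y + th^-1) / 2); first by lra.
exists tail => //; apply: (abs_summable_geometric _ (ltW th0) _ tailB').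
  by lra.
by rewrite mulrC -ltr_pdivlMr// mul1r; lra.
Qed.

Lemma pole_neq0 k y : lambda * q ^+ k * y != 1 -> (pole k).[y] != 0.
Proof. by move=> ky; rewrite !hornerE subr_eq0 eq_sym. Qed.

Lemma mittag_leffler_radius y : exists M, forall N, (M <= N)%N ->
  nc (lambda * q ^+ N) * nc y < 1.
Proof.
have [M MP] := pow_small (nc_ge0 q) q1 (nc lambda * nc y) ltr01.
by exists M => N /MP; rewrite ncM ncX mulrAC.
Qed.

Lemma regular_off_poles y : (forall k, lambda * q ^+ k * y != 1) -> regular 0 y f.
Proof.
move=> ky; have [kappa _ ml] := mittag_leffler.
have [M /(_ M (leqnn M)) My] := mittag_leffler_radius y.
rewrite -[f](subrK (\sum_(k < M) pt (kappa * u k)%:P * (pt (pole k))^-1)).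
apply: regularD; first exact/holo_regular/ml.
apply: regular_sum => k _; apply: regularM; first exact: regular_pt.
by apply: regularV; exact: pole_neq0.
Qed.

Lemma simple_pole y k : lambda * q ^+ k * y = 1 -> u k != 0 ->
  exists2 c : C, c != 0 & vanish 0 y (pt ('X - y%:P) * f - pt c%:P).
Proof.
move=> ky uk; have [kappa kappa0 ml] := mittag_leffler.
have lq0 : lambda * q ^+ k != 0 by rewrite mulf_neq0// expf_neq0.
have yE : y = (lambda * q ^+ k)^-1 by apply: (mulfI lq0); rewrite ky divff.
have [M MP] := mittag_leffler_radius y.
(* Enough polar parts to be holomorphic at y, the k-th one included. *)
pose N := (M + k.+1)%N; have kN : (k < N)%N by rewrite leq_addl.
have Ny := MP N (leq_addr _ _).
(* The residue at y, since kappa u_k / (1 - z/y) = - kappa u_k y / (z - y). *)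
pose c := - (kappa * u k * y); exists c.
  by rewrite oppr_eq0 !mulf_neq0// yE invr_eq0.
pose g i := pt (kappa * u i)%:P * (pt (pole i))^-1.
have gk : pt ('X - y%:P) * g k = pt c%:P.
  have p0 : pt (pole k) != 0 by rewrite (@pt_neq0 _ _ 0)// pole_neq0// mulr0 eq_sym oner_neq0.
  have XE : 'X - y%:P = - (y%:P * pole k).
    by rewrite -mul_polyC mulrBr mulr1 mulrA -polyCM mulrC [y * _]mulrC ky mulr1 opprB.
  by rewrite XE /g /c polyCN polyCM !rmorphN !rmorphM mulNr mulrACA divff// mulr1 mulrC.
have -> : pt ('X - y%:P) * f - pt c%:P = pt ('X - y%:P) *
    (f - \sum_(i < N) g i + \sum_(i < N | i != Ordinal kN) g i).
  rewrite [in RHS](bigD1 (Ordinal kN))//= -gk; ring.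
apply: vanishMr; first by apply: vanish_pt; rewrite hornerXsubC subrr.
apply: regularD; first exact/holo_regular/ml.
apply: regular_sum => i ik; apply: regularM; first exact: regular_pt.
apply: regularV; apply: pole_neq0; apply: contra_neq ik => iy.
apply/val_inj => /=; apply: (nc_exp_inj (_ : 0 < nc q) q1); first by rewrite nc_gt0.
by apply: (mulfI lambda0); rewrite -[RHS]mulr1 -iy mulrCA ky mulr1.
Qed.

End MittagLeffler.

(** * Algebraic independence of the shifts *)

Section FiniteTypeEquation.
Variables (R : realType) (j : nat) (q0 : R[i]) (qs : nat -> R[i]).
Hypotheses (q00 : q0 != 0) (qsP : compatible_roots q0 qs).
Local Notation C := R[i].
Local Notation L := (puiseux C).
Local Notation pt := (@pt C j).
Local Notation sg := (sigma qs).
Local Notation p := (qs j.+1).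
Implicit Types (w : L) (P : {poly C}).

Lemma sigma_iterD m (w w' : L) : iter m sg (w + w') = iter m sg w + iter m sg w'.
Proof. by elim: m => //= m ->; rewrite sigmaD. Qed.

Lemma sigma_iterM m (w w' : L) : iter m sg (w * w') = iter m sg w * iter m sg w'.
Proof. by elim: m => //= m ->; rewrite (sigmaM q00 qsP). Qed.

Lemma sigma_iter_sum m (I : Type) (s : seq I) (Pr : pred I) (F : I -> L) :
  iter m sg (\sum_(i <- s | Pr i) F i) = \sum_(i <- s | Pr i) iter m sg (F i).
Proof. by elim: m => //= m ->; rewrite sigma_sum. Qed.

Lemma sigma_iter_pt m P : iter m sg (pt P) = pt (P \Po (p ^+ m *: 'X)).
Proof.
elim: m => [|m IH]; first by rewrite scale1r comp_polyXr.
rewrite /= IH (sigma_pt j _ qsP) -comp_polyA; congr (pt (_ \Po _)).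
by rewrite comp_polyZ comp_polyX scalerA -exprSr.
Qed.

Lemma sigma_iter_ptXn m e : iter m sg (pt 'X^e) = pt (p ^+ (m * e))%:P * pt 'X^e.
Proof.
rewrite sigma_iter_pt -rmorphM mul_polyC; congr pt.
by rewrite comp_Xn_poly exprZn exprM.
Qed.

Lemma span_scale U (c : C) w : c != 0 -> span j U (pt c%:P * w) -> span j U w.
Proof.
move=> c0 /(spanZ c^-1%:P); rewrite mulrA -rmorphM -polyCM mulVf// polyC1.
by rewrite rmorph1 mul1r.
Qed.

(** The coefficient of the highest shift is a monomial, so solving for that shift introduces only
    powers of t as denominators; strong induction on k then expresses every iterate through the
    first N. *)
Lemma finite_type_equation w N e (P : nat -> {poly C}) :
  pt 'X^e * iter N sg w = \sum_(i < N) pt (P i) * iter i sg w ->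
  finite_type j qs w.
Proof.
move=> wE; pose U := [seq iter i sg w | i <- iota 0 N]; exists U => k.
have [m] := ubnP k; elim: m k => // m IH k; rewrite ltnS => km.
have [kN|Nk] := ltnP k N.
  exists 0%N; rewrite rmorph1 mul1r; apply: span_mem; apply: map_f.
  by rewrite mem_iota.
pose d := (k - N)%N; have kE : k = (d + N)%N by rewrite subnK.
have /choice[E EP] : forall i : nat, exists e', (i < N)%N ->
    span j U (pt 'X^e' * iter (d + i) sg w).
  move=> i; have [iN|] := ltnP i N; last by exists 0%N.
  have [|e' he'] := IH (d + i)%N; last by exists e'.
  by rewrite (leq_trans _ km)// kE ltn_add2l.
(* One exponent that is large enough for all N terms. *)
pose S := (\sum_(i < N) E i)%N; exists (S + e)%N.
have := congr1 (iter d sg) wE.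
rewrite sigma_iterM sigma_iter_ptXn -iterD -kE sigma_iter_sum => kw.
apply: (@span_scale _ (p ^+ (d * e))).
  by rewrite expf_neq0// (qs_neq0 q00 qsP).
have -> : pt (p ^+ (d * e))%:P * (pt 'X^(S + e) * iter k sg w) =
    pt 'X^S * (pt (p ^+ (d * e))%:P * pt 'X^e * iter k sg w).
  by rewrite exprD rmorphM /=; ring.
rewrite kw mulr_sumr; elim/big_ind: _; [exact: span0|exact: spanD|move=> i _].
rewrite sigma_iterM -iterD sigma_iter_pt mulrCA; apply: spanZ.
rewrite {1}/S (bigD1 i)//= addnC exprD rmorphM /= -mulrA; apply: spanZ.
exact: EP.
Qed.

Variables (q0' : C) (qs' : nat -> C).
Hypotheses (q00' : q0' != 0) (qsP' : compatible_roots q0' qs').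

Lemma span_sigma U w : span j U w -> span j (map (sigma qs') U) (sigma qs' w).
Proof.
elim: U w => [|u U IH] w /=; first by move=> ->; exact: sigma0.
move=> [P /IH]; rewrite sigmaD -mulNr -rmorphN (sigmaM q00' qsP') (sigma_pt j _ qsP').
by move=> h; exists (- (- P \Po (qs' j.+1 *: 'X))); rewrite rmorphN mulNr opprK.
Qed.

(** The two dilations commute and a dilation only rescales t^e, so the images of the generators
    serve for the image of w. *)
Lemma finite_type_sigma w : finite_type j qs w -> finite_type j qs (sigma qs' w).
Proof.
move=> [U hU]; exists (map (sigma qs') U) => k; have [e /span_sigma he] := hU k.
exists e; apply: (@span_scale _ (qs' j.+1 ^+ e)).
  by rewrite expf_neq0// (qs_neq0 q00' qsP').
move: he; rewrite (sigmaM q00' qsP') (sigma_pt j _ qsP') comp_Xn_poly exprZn.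
by rewrite -mul_polyC rmorphM /= -mulrA sigma_iter_comm.
Qed.

Lemma finite_type_sigma_iter w l :
  finite_type j qs w -> finite_type j qs (iter l (sigma qs') w).
Proof. by move=> hw; elim: l => //= l; exact: finite_type_sigma. Qed.

End FiniteTypeEquation.

(** * Poles of the shifts and induction on their number *)

Section Core.
Variables (R : realType) (q : R[i]) (qs : nat -> R[i]).
Variables (Q : R[i]) (Qs : nat -> R[i]) (lambda : R[i]) (f : puiseux R[i]).
Local Notation C := R[i].
Local Notation L := (puiseux C).
Local Notation sg := (sigma qs).
Local Notation sQ := (sigma Qs).
Hypotheses (q0 : q != 0) (q1 : nc q < 1) (qsP : compatible_roots q qs).
Hypotheses (Q0 : Q != 0) (QsP : compatible_roots Q Qs).
Hypothesis indep : forall l m : int, q ^ l * Q ^ m = 1 -> l = 0 /\ m = 0.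
Hypothesis lambda0 : lambda != 0.
Hypothesis f_regular : forall y, (forall k, lambda * q ^+ k * y != 1) ->
  regular 0 y f.
Hypothesis f_pole : exists K, forall k, (K <= k)%N -> forall y,
  lambda * q ^+ k * y = 1 ->
  exists2 c : C, c != 0 & vanish 0 y (pt 0 ('X - y%:P) * f - pt 0 c%:P).
Hypothesis f_finite : forall j, finite_type j qs f.
Hypothesis f_near0 : exists2 e, 0 < e & forall y, nc y < e -> holo 0 y f.

Local Notation fl l := (iter l sQ f).
Local Notation ptz := (@pt C 0).

Section Level.
Variables (j N : nat).
Local Notation pt := (@pt C j).
Local Notation p := (qs j.+1).
Local Notation pQ := (Qs j.+1).

(** In the variable t, the points tau p^-k lie above the poles z = 1 / (lambda Q^N q^k) of f(Q^N
    z). *)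
Let tau : C := j.+1.-root (lambda * Q ^+ N)^-1.

Let tauE : tau ^+ j.+1 = (lambda * Q ^+ N)^-1.
Proof. exact: rootCK. Qed.

Let tau0 : tau != 0.
Proof.
apply: contra_eq_neq tauE => ->; rewrite expr0n eq_sym invr_eq0 mulf_neq0//.
exact: expf_neq0.
Qed.

Let pE : p ^+ j.+1 = q. Proof. exact: qsP.1. Qed.
Let pQE : pQ ^+ j.+1 = Q. Proof. exact: QsP.1. Qed.
Let p0 : p != 0. Proof. exact: (qs_neq0 q0 qsP). Qed.
Let pQ0 : pQ != 0. Proof. exact: (qs_neq0 Q0 QsP). Qed.

Let p1 : nc p < 1.
Proof.
rewrite ltNge; apply/negP => p1; have : 1 <= nc p ^+ j.+1 by rewrite exprn_ege1.
by rewrite -ncX pE leNgt q1.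
Qed.

Let spiral l k : (pQ ^+ l * (tau * p ^- k)) ^+ j.+1 =
  Q ^+ l / (lambda * Q ^+ N) / q ^+ k.
Proof. by rewrite !exprMn tauE exprVn -!exprM -pE -pQE -!exprM ![(j.+1 * _)%N]mulnC mulrA. Qed.

(** What the coefficients of a relation must satisfy: regularity on the spiral to compare polar
    parts there, finite type to propagate zeros, and convergence near 0 to conclude. *)
Definition good (w : L) := [/\ finite_type j qs w,
  (exists2 r, 0 < r & forall x, nc x < r -> holo j x w) &
  forall k, regular j (tau * p ^- k) w].

Lemma goodD w w' : good w -> good w' -> good (w + w').
Proof.
move=> [fw [r r0 hw] rw] [fw' [r' r'0 hw'] rw']; split.
- exact: finite_typeD.
- exists (Num.min r r'); first by rewrite lt_min r0.
  by move=> x; rewrite lt_min => /andP[xr xr']; apply: holoD; [exact: hw|exact: hw'].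
- by move=> k; exact: regularD.
Qed.

Lemma goodM w w' : good w -> good w' -> good (w * w').
Proof.
move=> [fw [r r0 hw] rw] [fw' [r' r'0 hw'] rw']; split.
- exact: (finite_typeM q0 qsP).
- exists (Num.min r r'); first by rewrite lt_min r0.
  by move=> x; rewrite lt_min => /andP[xr xr']; apply: holoM; [exact: hw|exact: hw'].
- by move=> k; exact: regularM.
Qed.

Lemma good_pt P : good (pt P).
Proof.
split; [exact: (finite_type_pt j qsP)| |by move=> k; exact: regular_pt].
by exists 1 => // x _; exact: holo_pt.
Qed.

Lemma good_shift l : (l < N)%N -> good (fl l).
Proof.
move=> lN; split.
- exact: (finite_type_sigma_iter Q0 QsP).
- have [e e0 he] := f_near0.
  have nQ : 0 < nc pQ ^+ l by rewrite exprn_gt0// nc_gt0.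
  (* The cap at 1 ensures that the (j+1)-th power does not increase the modulus. *)
  have m0 : 0 < Num.min e 1 by rewrite lt_min e0 ltr01.
  exists (Num.min e 1 / nc pQ ^+ l) => [|x]; first by rewrite divr_gt0.
  rewrite ltr_pdivlMr// => xe; apply: (holo_sigma_iter Q0 QsP).
  apply: holo_widen; apply: he; rewrite ncX.
  have ne : nc (pQ ^+ l * x) < Num.min e 1 by rewrite ncM ncX mulrC.
  apply: le_lt_trans (_ : nc (pQ ^+ l * x) < _).
    rewrite exprS ler_piMr ?nc_ge0// exprn_ile1 ?nc_ge0// ltW//.
    by move: ne; rewrite lt_min => /andP[].
  by move: ne; rewrite lt_min => /andP[].
move=> k; apply: (regular_sigma_iter Q0 QsP); apply: regular_widen.
apply: f_regular => i; rewrite spiral; apply/eqP => e.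
have Nl : N = (l + (N - l))%N by rewrite subnKC// ltnW.
(* A pole of f(Q^l z) on the spiral of f(Q^N z) gives q^(i-k) Q^(l-N) = 1, hence l = N. *)
have := @indep (i%:Z - k%:Z) (l%:Z - N%:Z).
case=> [|_ /eqP]; last by rewrite subr_eq0 eqz_nat ltn_eqF.
rewrite !expfzDr// -!exprnN -!exprnP; rewrite -{}e.
by field; rewrite lambda0 !expf_neq0.
Qed.

Lemma vanish_pow x (v : L) (c : C) D :
  vanish j x (v - pt c%:P) -> vanish j x (v ^+ D - pt (c ^+ D)%:P).
Proof.
move=> hv; rewrite rmorphXn /= rmorphXn subrXX; apply: vanishMr => //.
have rv : regular j x v.
  by rewrite -[v](subrK (pt c%:P)); apply: regularD; [exact: vanish_regular|exact: regular_pt].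
by apply: regular_sum => i _; apply: regularM; apply: regularX => //; exact: regular_pt.
Qed.

(** At a point x of the spiral with index k >= K, f(Q^N z) has a simple pole, cancelled by a factor
    Z that vanishes at x; the product v takes a nonzero value c there. In the relation multiplied by
    Z^D, every term but Phi_D v^D retains a factor Z, so Phi_D vanishes at x and [finite_type_eq0]
    applies. *)
Lemma lead_coef_eq0 (Phi : nat -> L) D : (forall d, good (Phi d)) ->
  \sum_(d < D.+1) Phi d * fl N ^+ d = 0 -> Phi D = 0.
Proof.
move=> hPhi rel; have [fPhi [r r0 holoPhi] _] := hPhi D.
have [K KP] := f_pole.
have [rho rho0 oPhi] : holo j 0 (Phi D) by apply: holoPhi; rewrite nc0.
rewrite nc0 in rho0.
apply: (finite_type_eq0 q0 qsP tau0 p1 rho0 oPhi fPhi (k0 := K)) => k Kk.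
set x := tau * p ^- k; pose y := (pQ ^+ N * x) ^+ j.+1.
have yE : lambda * q ^+ k * y = 1.
  by rewrite /y spiral; field; rewrite lambda0 !expf_neq0.
have [c c0 vc] := KP k Kk y yE.
(* The N-th shift of z - y, where y = Q^N x^(j+1) is a pole of f. *)
pose Z := iter N sQ (ptz ('X - y%:P)).
have lift w : vanish 0 y w -> vanish j x (iter N sQ w).
  by move=> vw; apply: (vanish_sigma_iter Q0 QsP); exact: vanish_widen.
have vZ : vanish j x Z by apply/lift/vanish_pt; rewrite hornerXsubC subrr.
have vv : vanish j x (Z * fl N - pt c%:P).
  have := lift _ vc; have -> : - ptz c%:P = ptz (- c)%:P.
    by rewrite polyCN rmorphN.
  rewrite sigma_iterD (sigma_iterM Q0 QsP).
  by rewrite (pt_widen j (- c)%:P) comp_polyC (sigma_iter_pt j QsP) comp_polyC polyCN rmorphN.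
set v := Z * fl N in vv.
have rv : regular j x v.
  by rewrite -[v](subrK (pt c%:P)); apply: regularD; [exact: vanish_regular|exact: regular_pt].
have rPhi d : regular j x (Phi d) by have [_ _] := hPhi d; apply.
have vD : vanish j x (Phi D * v ^+ D).
  have -> : Phi D * v ^+ D = - \sum_(d < D) Phi d * v ^+ d * Z ^+ (D - d).
    apply/eqP; rewrite -subr_eq0 opprK addrC; apply/eqP.
    have := congr1 (fun w => w * Z ^+ D) rel; rewrite mul0r big_ord_recr /= mulrDl.
    rewrite /v -mulrA -exprMn [fl N * Z]mulrC => e; rewrite -[RHS]e; congr (_ + _).
    rewrite mulr_suml; apply: eq_bigr => d _.
    have -> : Z ^+ D = Z ^+ (D - d) * Z ^+ d by rewrite -exprD subnK// ltnW.
    by rewrite exprMn; ring.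
  apply: vanishN; apply: vanish_sum => d _; apply: vanishMl.
    by apply: regularM => //; exact: regularX.
  have -> : (D - d = (D - d).-1.+1)%N by rewrite prednK// subn_gt0.
  rewrite exprS; apply: vanishMr => //; apply: regularX.
  exact: vanish_regular.
apply: (@vanish_cancel _ _ _ (c ^+ D)%:P); first by rewrite hornerC expf_neq0.
have -> : pt (c ^+ D)%:P * Phi D =
    Phi D * v ^+ D - Phi D * (v ^+ D - pt (c ^+ D)%:P) by ring.
by apply: vanishB => //; apply: vanishMl => //; exact: vanish_pow.
Qed.

Lemma coef_eq0 (Phi : nat -> L) D : (forall d, good (Phi d)) ->
  \sum_(d < D) Phi d * fl N ^+ d = 0 -> forall d, (d < D)%N -> Phi d = 0.
Proof.
move=> hPhi; elim: D => // D IH rel d; rewrite ltnS leq_eqVlt.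
have D0 := lead_coef_eq0 hPhi rel => /predU1P[->//|]; apply: IH.
by move: rel; rewrite big_ord_recr /= D0 mul0r addr0.
Qed.

Lemma good_sum (I : Type) (s : seq I) (Pr : pred I) (F : I -> L) :
  (forall i, Pr i -> good (F i)) -> good (\sum_(i <- s | Pr i) F i).
Proof.
move=> hF; elim/big_ind: _ => //; last exact: goodD.
by rewrite -(rmorph0 pt); exact: good_pt.
Qed.

Lemma good_prod (I : Type) (s : seq I) (Pr : pred I) (F : I -> L) :
  (forall i, Pr i -> good (F i)) -> good (\prod_(i <- s | Pr i) F i).
Proof.
move=> hF; elim/big_ind: _ => //; last exact: goodM.
by rewrite -(rmorph1 pt); exact: good_pt.
Qed.

Lemma good_exp w k : good w -> good (w ^+ k).
Proof.
move=> hw; elim: k => [|k IH]; last by rewrite exprS; exact: goodM.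
by rewrite expr0 -(rmorph1 pt); exact: good_pt.
Qed.

End Level.
(** Induction on the number of shifts. Once denominators are cleared, the coefficients of P in its
    last variable, evaluated at the lower shifts, are [good]; [coef_eq0] makes these values zero,
    and the induction hypothesis makes the coefficients themselves zero. *)
Lemma shifts_independent : alg_independent (@puiseux_ratfun C) (fun i => fl i).
Proof.
elim=> [|n IH] P PK P0.
  rewrite (nvar0_mpolyC P) in P0 *; move: P0; rewrite mevalC => ->.
  exact: mpolyC0.
have [|j [H [H0 hH]]] := @common_denominator _ [seq mcoeff m P | m <- msupp P].
  by move=> _ /mapP[m _ ->].
pose P' := pt j H *: P.
have ptH : pt j H != 0 by rewrite pt_eq0.
have P'c m : exists A, mcoeff m P' = pt j A.
  rewrite mcoeffZ; have [mP|] := boolP (m \in msupp P); last first.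
    by move=> /memN_msupp_eq0 ->; exists 0; rewrite mulr0 rmorph0.
  by apply: hH; apply: map_f.
suff P'0 : P' = 0.
  by rewrite -[P]scale1r -(mulVf ptH) -scalerA -/P' P'0 scaler0.
apply: last_coef_eq0 => d.
have Kd e e' : exists A, mcoeff e (last_coef P' e') = pt j A.
  rewrite /last_coef raddf_sum /=; elim/big_ind: _ => [|x y [A ->] [B ->]|m _].
  - by exists 0; rewrite rmorph0.
  - by exists (A + B); rewrite rmorphD.
  have [A hA] := P'c m; exists (A * (restr_mnm m == e)%:R).
  by rewrite mcoeffZ mcoeffX hA rmorphM rmorph_nat.
apply: IH => [e|]; first by have [A ->] := Kd e d; exact: pt_ratfun.
have [D DP] := meval_last_coef (fun i => fl i) P'.
(* The range of summation has to contain the degree d under consideration. *)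
pose D' := maxn D d.+1.
apply: (@coef_eq0 j n (fun d => meval (fun i : 'I_n => fl i) (last_coef P' d)) D').
- move=> e; rewrite mevalE; apply: good_sum => m _; apply: goodM.
    have [A ->] := Kd m e.
    exact: good_pt.
  by apply: good_prod => i _; apply: good_exp; exact: good_shift.
- by rewrite -(DP D') ?leq_maxl// mevalZ P0 mulr0.
by rewrite leq_maxr.
Qed.

End Core.

(** * The hypergeometric equation *)

Section LinearFactors.
Variables (K : idomainType) (T : Type) (c : T -> K).

Lemma size_prod_linear (r : seq T) :
  (size (\prod_(i <- r) (1 - c i *: 'X))%R <= (size r).+1)%N /\
  (\prod_(i <- r) (1 - c i *: 'X))`_(size r) = \prod_(i <- r) (- c i).
Proof.
elim: r => [|i r [IHs IHc]]; first by rewrite !big_nil size_poly1 coef1.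
rewrite !big_cons /=; set P := \prod_(k <- r) _ in IHs IHc *.
have coefE k : ((1 - c i *: 'X) * P)`_k.+1 = P`_k.+1 - c i * P`_k.
  by rewrite mulrBl mul1r -scalerAl coefB coefZ coefXM.
split; last by rewrite coefE IHc nth_default// sub0r mulNr.
apply/leq_sizeP => k; case: k => // k; rewrite ltnS => rk.
by rewrite coefE !nth_default ?mulr0 ?subr0// (leq_trans IHs)// ltnW.
Qed.

End LinearFactors.

Section Hypergeometric.
Variables (R : realType) (q : R[i]) (qs : nat -> R[i]).
Hypotheses (q0 : q != 0) (qsP : compatible_roots q qs).
Variables (n s : nat) (a : 'I_n -> R[i]) (b : 'I_s -> R[i]) (lambda : R[i]).
Hypotheses (sn : (s < n)%N) (lambda0 : lambda != 0).
Hypothesis a0 : forall i, a i != 0.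
Hypothesis bq : forall j m, b j * q ^+ m != 1.
Hypothesis bq1 : exists j, b j = q.
Local Notation C := R[i].
Local Notation sg := (sigma qs).
Local Notation A := (\prod_i (1 - a i *: 'X)).
Local Notation B := (\prod_j (1 - b j *: 'X)).

Definition hyp_coef (m : nat) : C :=
  (\prod_i qpochhammer (a i) q m) / (\prod_j qpochhammer (b j) q m).

Lemma horner_linear_prod (I : finType) (c : I -> C) x :
  (\prod_i (1 - c i *: 'X)).[x] = \prod_i (1 - c i * x).
Proof. by rewrite horner_prod; apply: eq_bigr => i _; rewrite !hornerE. Qed.

Lemma hyp_denominator_neq0 m : B.[q ^+ m] != 0.
Proof. by apply: horner_prod_neq0 => j _. Qed.

Lemma qpochhammer_prodS (I : finType) (c : I -> C) m :
  \prod_i qpochhammer (c i) q m.+1 =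
  (\prod_i qpochhammer (c i) q m) * (\prod_i (1 - c i *: 'X)).[q ^+ m].
Proof.
rewrite horner_linear_prod -big_split; apply: eq_bigr => i _.
exact: big_ord_recr.
Qed.

Lemma hyp_coef_rec m : B.[q ^+ m] * hyp_coef m.+1 = A.[q ^+ m] * hyp_coef m.
Proof.
have Bm := hyp_denominator_neq0 m.
have D0 : \prod_j qpochhammer (b j) q m != 0.
  apply/prodf_neq0 => j _; apply/prodf_neq0 => k _.
  by rewrite subr_eq0 eq_sym bq.
rewrite /hyp_coef !qpochhammer_prodS; field.
by rewrite Bm D0.
Qed.

Lemma hyp_coef_neq0 m : (forall i k, a i * q ^+ k != 1) -> hyp_coef m != 0.
Proof.
move=> aq; rewrite mulf_neq0 ?invr_eq0//.
all: apply/prodf_neq0 => j _; apply/prodf_neq0 => k _.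
all: by rewrite subr_eq0 eq_sym ?aq ?bq.
Qed.

(** A q-difference operator with constant coefficients is diagonal on monomials: it multiplies z^m
    by P(q^m). *)
Lemma operator_ser (P : {poly C}) N (c : nat -> C) : (size P <= N)%N ->
  \sum_(i < N) pt 0 (P`_i)%:P * iter i sg (ser 0 c) =
  ser 0 (fun m => P.[q ^+ m] * c m).
Proof.
have iterE i : iter i sg (ser 0 c) = ser 0 (fun m => (q ^+ m) ^+ i * c m).
  elim: i => [|i IH]; first by congr ser; apply/funext => m; rewrite mul1r.
  rewrite /= IH (sigma_ser 0 _ qsP) (qs1 qsP); congr ser; apply/funext => m.
  by rewrite mulrA -exprS.
move=> PN; transitivity (ser 0 (fun m => \sum_(i < N) P`_i * (q ^+ m) ^+ i * c m)).
  elim: (N) => [|k IH].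
    rewrite big_ord0 -(ser0 _ 0); congr ser; apply/funext => m.
    by rewrite big_ord0.
  rewrite big_ord_recr /= IH iterE pt_C_ser -serD; congr ser.
  by apply/funext => m; rewrite big_ord_recr /= -mulrA.
by congr ser; apply/funext => m; rewrite (horner_coef_wide _ PN) mulr_suml.
Qed.

Local Notation f := (basic_hypergeometric a b lambda q).

(** The recursion on coefficients says that Bq(sigma) f = lambda z A(sigma) f. As s < n, only the
    right side contains the n-th shift, with coefficient lambda A_n z, so one can solve for z times
    that shift with polynomial coefficients. *)
Lemma hyp_equation : exists P : nat -> {poly C},
  pt 0 'X * iter n sg f = \sum_(i < n) pt 0 (P i) * iter i sg f.
Proof.
(* Dividing the b_j by q makes up for the factor z on the other side: Bq(q^(m+1)) = B(q^m). *)
pose Bq : {poly C} := \prod_j (1 - (b j / q) *: 'X).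
pose c m := hyp_coef m * lambda ^+ m.
have szI (I : finType) : size (index_enum I) = #|I| by rewrite cardE [index_enum _]unlock enumT.
have sz (I : finType) (e : I -> C) :
    (size (\prod_i (1 - e i *: 'X))%R <= #|I|.+1)%N.
  have [+ _] := size_prod_linear e (index_enum I).
  by rewrite szI.
have [_ An] := size_prod_linear a (index_enum 'I_n).
rewrite szI card_ord in An.
have An0 : lambda * A`_n != 0.
  by rewrite mulf_neq0// An; apply/prodf_neq0 => i _; rewrite oppr_eq0.
have szB : (size Bq <= n)%N.
  by apply: leq_trans (sz _ _) _; rewrite card_ord.
have szA : (size (A : {poly C}) <= n.+1)%N by have := sz _ a; rewrite card_ord.
have eqn : \sum_(i < n) pt 0 (Bq`_i)%:P * iter i sg f =
    pt 0 (lambda *: 'X) * \sum_(i < n.+1) pt 0 (A`_i)%:P * iter i sg f.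
  rewrite (operator_ser c szB) (operator_ser c szA) -mul_polyC rmorphM /= -mulrA.
  rewrite -['X]expr1 pt_Xn_ser pt_C_ser; congr ser; apply/funext => -[|m] /=.
    (* The constant term: Bq(1) = 0 because some b_j equals q. *)
    have [j bj] := bq1; rewrite mulr0 horner_linear_prod (bigD1 j)//= bj.
    by rewrite mulr1 divff// subrr !mul0r.
  have -> : Bq.[q ^+ m.+1] = B.[q ^+ m].
    rewrite !horner_linear_prod; apply: eq_bigr => j _.
    by rewrite exprS mulrA divfK.
  by rewrite /c mulrA hyp_coef_rec subn1 /= exprS; ring.
exists (fun i => (lambda * A`_n)^-1 *: ((Bq`_i)%:P - (lambda * A`_i) *: 'X)).
have l0 : pt 0 (lambda * A`_n)%:P != 0 by rewrite pt_eq0 polyC_eq0.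
apply: (mulfI l0); rewrite mulr_sumr.
transitivity (\sum_(i < n) (pt 0 (Bq`_i)%:P * iter i sg f
    - pt 0 (lambda *: 'X) * (pt 0 (A`_i)%:P * iter i sg f))).
  have sumE := mulr_sumr (index_enum 'I_n) xpredT
    (fun i => pt 0 (A`_i)%:P * iter i sg f) (pt 0 (lambda *: 'X)).
  rewrite sumrB eqn -{}sumE big_ord_recr /= -mul_polyC polyCM !rmorphM /=.
  by move: (\sum_(i < n) _) => S; ring.
apply: eq_bigr => i _; rewrite [RHS]mulrA -rmorphM mul_polyC scalerA divff//.
rewrite scale1r rmorphB -!mul_polyC polyCM !rmorphM /=; ring.
Qed.

Lemma hyp_finite_type j : finite_type j qs f.
Proof.
have [P eqn] := hyp_equation.
apply: (@finite_type_equation _ j q qs q0 qsP f n j.+1 (fun i => P i \Po 'X^(j.+1))).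
have := eqn; rewrite (pt_widen j) comp_polyX => ->.
by apply: eq_bigr => i _; rewrite (pt_widen j).
Qed.

End Hypergeometric.

(** * Moduli of powers of q and its compatible roots *)

Section Exponential.
Variable R : realType.
Implicit Types (x : R[i]) (t : R).

Lemma nc_cexp x : nc (cexp x) = expR (complex.Re x).
Proof.
case: x => u v; rewrite /nc /= !exprMn -mulrDr cos2Dsin2 mulr1.
by rewrite sqrtr_sqr ger0_norm ?expR_ge0.
Qed.

Lemma cexpX x m : cexp x ^+ m = cexp (m%:R * x).
Proof.
elim: m => [|m IH].
  by rewrite mul0r /cexp /= expR0 cos0 sin0 mulr1 mulr0.
by rewrite exprS IH -cexpD -{1}[x]mul1r -mulrDl addrC natr1.
Qed.

Lemma nc_qpow logq t : nc (qpow logq t%:C%C) = expR (t * complex.Re logq).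
Proof. by rewrite nc_cexp; case: logq => u v /=; rewrite mul0r subr0. Qed.

Lemma qpow_roots (logq : R[i]) :
  compatible_roots (cexp logq) (fun j => cexp (j%:R^-1 * logq)).
Proof.
split=> [j j0|j k l j0 jE]; rewrite cexpX mulrA.
  by rewrite divff ?mul1r// pnatr_eq0 -lt0n.
have := j0; rewrite jE muln_gt0 => /andP[l0 k0].
by rewrite natrM invfM mulrA divff ?mul1r// pnatr_eq0 -lt0n.
Qed.

End Exponential.

Theorem corollary8p4 (R : realType)
  (q logq : R[i]) (q_gt0 : 0 < `|q|) (q_lt1 : `|q| < 1)
  (logqE : cexp logq = q)
  (qq : R[i]) (qq_neq0 : qq != 0) (qq_norm : `|qq| != 1)
  (q_qq_indep : forall l m : int, q ^ l * qq ^ m = 1 -> l = 0 /\ m = 0)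
  (qqs : nat -> R[i]) (qqsP : compatible_roots qq qqs)
  (n s : nat) (ns : (s < n)%N) (s_ge1 : (1 <= s)%N) (n_ge2 : (2 <= n)%N)
  (a : 'I_n -> R[i]) (b : 'I_s -> R[i]) (lambda : R[i])
  (aP : forall i, a i \in qpow_real logq)
  (bP : forall j, b j \in qpow_real logq `\` qpow_negnat q)
  (b1 : b (Ordinal s_ge1) = q)
  (lambda_neq0 : lambda != 0)
  (alpha : 'I_n -> R) (beta : 'I_s -> R)
  (alphaP : forall i, a i = qpow logq (alpha i)%:C%C)
  (betaP : forall j, b j = qpow logq (beta j)%:C%C)
  (alpha_beta : forall i j, alpha i - beta j \isn't a Num.int)
  (conn : connected (alg_group_generated
     (diag_mx (\row_(i < n) cexp (0 +i* (2 * pi * alpha i))%C)))) :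
  sigma_transcendental qqs (basic_hypergeometric a b lambda q).
Proof.
have q0 : q != 0 by rewrite -normr_gt0.
have q1 : nc q < 1 by rewrite -ltcR -ncE.
pose ell := complex.Re logq.
have ncq : nc q = expR ell by rewrite -logqE nc_cexp.
have ell0 : ell < 0 by rewrite -expR_lt1 -ncq.
have na i : nc (a i) = expR (alpha i * ell) by rewrite alphaP nc_qpow.
have nb j : nc (b j) = expR (beta j * ell) by rewrite betaP nc_qpow.
have nqX m : nc q ^+ m = expR (m%:R * ell) by rewrite ncq -expRM_natl.
(* As log |q| is nonzero, real exponents can be read off moduli. *)
have ell_inj x y : expR (x * ell) = expR (y * ell) -> x = y.
  by move=> /expR_inj/mulIf; apply; rewrite lt_eqF.
have beta1 : beta (Ordinal s_ge1) = 1.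
  by apply: ell_inj; rewrite -nb b1 ncq mul1r.
have a0 i : a i != 0 by rewrite -nc_gt0 na expR_gt0.
(* Since beta_1 = 1, an equality here would make alpha_i - beta_1 the integer -(k+1). *)
have aq i k : a i * q ^+ k != 1.
  apply/eqP => /(congr1 (@nc R)); rewrite ncM ncX nc1 na nqX -expRD -mulrDl.
  rewrite -[RHS]expR0 -(mul0r ell) => /ell_inj e.
  have := alpha_beta i (Ordinal s_ge1); rewrite beta1.
  have -> : alpha i - 1 = - k.+1%:R by rewrite -natr1; lra.
  by rewrite rpredN natr_int.
have bq j k : b j * q ^+ k != 1.
  apply/eqP => e; have := bP j; rewrite inE => -[_]; apply; exists k.
  by apply: (mulIf (expf_neq0 k q0)); rewrite e mulVf// expf_neq0.
have ba i j k : b j * q ^+ k != a i.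
  apply/eqP => /(congr1 (@nc R)); rewrite ncM ncX na nb nqX -expRD -mulrDl.
  move=> /ell_inj e; have := alpha_beta i j.
  by rewrite -e addrC addKr natr_int.
(* The fixed logarithm provides compatible roots of q, hence a dilation by q on Puiseux series. *)
pose qs j := cexp (j%:R^-1 * logq).
have qsP : compatible_roots q qs by rewrite -logqE; exact: qpow_roots.
have [_ [[u [rho [-> u0 rho0 su]]] uE]] := q_product_ex q0 q1 qsP a b.
have uP : solves qs (\prod_i (1 - a i *: 'X)) (\prod_j (1 - b j *: 'X)) (ser 0 u).
  by split=> //; exists u, rho.
have d0 m := hyp_coef_neq0 bq m aq.
have dP := hyp_coef_rec a bq.
have Bq := hyp_denominator_neq0 bq.
apply: (shifts_independent q0 q1 qsP qq_neq0 qqsP q_qq_indep lambda_neq0).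
- exact: (regular_off_poles q0 q1 qsP uP lambda_neq0 d0 dP Bq).
- have n0 : (0 < n)%N by apply: ltn_trans n_ge2.
  (* As log |q| < 0, the least alpha_i gives the a_i of largest modulus; equal moduli mean equal
     exponents, so there is a single dominant value. *)
  have [i0 _ i0_min] := Order.TotalTheory.arg_minP alpha (isT : xpredT (Ordinal n0)).
  have [N uN] : exists N, forall k, (N <= k)%N -> u k != 0.
    apply: (solution_coef_neq0 q0 q1 qsP uP (a0 i0)) => [i|i|j m]; last exact: ba.
      by rewrite !na ler_expR ler_nM2r// i0_min.
    by rewrite !na => /ell_inj e; rewrite !alphaP e.
  exists N => k /uN uk y ky.
  exact: (simple_pole q0 q1 qsP uP lambda_neq0 d0 dP Bq ky uk).
- move=> j; apply: (hyp_finite_type q0 qsP ns lambda_neq0 a0 bq).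
  by exists (Ordinal s_ge1).
(* With no polar part removed, the decomposition says that the series converges where |lambda y| <
   1. *)
have [kappa _ /(_ 0%N) ml] := mittag_leffler q0 q1 qsP uP lambda_neq0 d0 dP Bq.
have nl : 0 < nc lambda by rewrite nc_gt0.
exists (nc lambda)^-1 => [|y]; first by rewrite invr_gt0.
rewrite -[_^-1]mul1r ltr_pdivlMr// => yl.
have := ml y; rewrite big_ord0 subr0; apply.
by rewrite expr0 mulr1 mulrC.
Qed.
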